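(* Let $G$ be a compact, odd-dimensional, semisimple Lie group. Then $G$ does not admit a left-invariant Levi-flat CR structure of maximal rank that is of type CR0.
   Context: Let $\mathfrak g$ be the Lie algebra of $G$, $\mathbb C\mathfrak g$ its complexification, $N=\dim G$. Left-invariant CR structures on $G$ correspond bijectively to complex Lie subalgebras $\mathfrak h\subset\mathbb C\mathfrak g$ with $\mathfrak h\cap\overline{\mathfrak h}=\{0\}$. Maximal rank means $\dim_{\mathbb C}\mathfrak h=[N/2]$ ($[\cdot]$ is the integer part), so for $N$ odd $\mathfrak h\oplus\overline{\mathfrak h}$ has codimension one. The structure is Levi-flat if for every nonzero real covector $\xi\in\mathfrak g^*$ annihilating $\mathfrak h$, the Levi form $\mathcal L_\xi(L,M)=\frac1{2i}\xi([L,\overline M])$, $L,M\in\mathfrak h$, vanishes identically. Let $\mathfrak t\subset\mathfrak g$ be a maximal abelian subalgebra, $d=\dim\mathfrak t$, $\Delta_+$ a system of positive roots of $\mathbb C\mathfrak t$ in $\mathbb C\mathfrak g$, and $\mathfrak g_\alpha$ the root spaces. A subalgebra $\mathfrak h\subset\mathbb C\mathfrak g$ is of type CR0 if it is conjugate, under $\operatorname{Ad}(g)$ for some $g\in G$, to a subalgebra of the form $\mathfrak m\oplus\bigoplus_{\alpha\in\Delta_+}\mathfrak g_\alpha$, where $\mathfrak m\subset\mathbb C\mathfrak t$ is a complex subspace of dimension $[d/2]$ with $\mathfrak m\cap\mathfrak g=\{0\}$. *)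

(* Defs.v *)
From HB Require Import structures.
From mathcomp Require Import all_boot all_order all_algebra.
From mathcomp Require Import all_classical all_reals all_analysis.
From mathcomp Require Import complex.
Set Implicit Arguments.
Unset Strict Implicit.
Unset Printing Implicit Defensive.
Import Order.TTheory GRing.Theory Num.Theory.
Import numFieldNormedType.Exports.
Local Open Scope classical_set_scope.
Local Open Scope ring_scope.

(* [Ck_on k U f] is meant for open [U]; C^(k+1) is: differentiable with all
   directional derivatives of class C^k. *)
Fixpoint Ck_on (R : realType) (V W : normedModType R) (k : nat)
    (U : set V) (f : V -> W) : Prop :=
  match k with
  | 0%N => forall x, U x -> {for x, continuous f}
  | k'.+1 => (forall x, U x -> differentiable f x) /\
             (forall v : V, Ck_on k' U ('D_v f))
  end.

Definition smooth_on (R : realType) (V W : normedModType R)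
    (U : set V) (f : V -> W) : Prop :=
  forall k, Ck_on k U f.

(* A homeomorphism between an open subset of [M] and an open subset of R^n;
   the values of the two total functions outside these subsets are junk. *)
Record chart (R : realType) (n : nat) (M : topologicalType) := Chart {
  chart_dom : set M;
  chart_img : set 'rV[R]_n;
  chart_fun :> M -> 'rV[R]_n;
  chart_inv : 'rV[R]_n -> M;
  chart_dom_open : open chart_dom;
  chart_img_open : open chart_img;
  chart_funS : forall x, chart_dom x -> chart_img (chart_fun x);
  chart_invS : forall y, chart_img y -> chart_dom (chart_inv y);
  chart_funK : forall x, chart_dom x -> chart_inv (chart_fun x) = x;
  chart_invK : forall y, chart_img y -> chart_fun (chart_inv y) = y;
  chart_fun_continuous : forall x, chart_dom x -> {for x, continuous chart_fun};
  chart_inv_continuous : forall y, chart_img y -> {for y, continuous chart_inv}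
}.

(* [chart_at x] is a chosen chart of the atlas around [x]; tangent vectors at
   [x] are identified with their coordinates in it. *)
HB.mixin Record Topological_Group_isLieGroup (R : realType) (n : nat) (G : Type)
    of Topological G & Group G := {
  atlas : set (chart R n G);
  chart_at : G -> chart R n G;
  chart_at_atlas : forall x, atlas (chart_at x);
  chart_at_dom : forall x, chart_dom (chart_at x) x;
  atlas_smooth : forall a b, atlas a -> atlas b ->
    smooth_on [set x | chart_img a x /\ chart_dom b (chart_inv a x)]
              (fun x => b (chart_inv a x));
  lie_hausdorff : hausdorff_space G;
  lie_second_countable : @second_countable G;
  lie_mul_continuous : continuous (fun p : G * G => (p.1 * p.2)%g);
  lie_mul_smooth : forall a b c, atlas a -> atlas b -> atlas c ->
    smooth_on
      [set p : 'rV[R]_n * 'rV[R]_n |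
        [/\ chart_img a p.1, chart_img b p.2 &
            chart_dom c (chart_inv a p.1 * chart_inv b p.2)%g]]
      (fun p => c (chart_inv a p.1 * chart_inv b p.2)%g);
  lie_inv_continuous : continuous (fun x : G => (x^-1)%g);
  lie_inv_smooth : forall a b, atlas a -> atlas b ->
    smooth_on [set x | chart_img a x /\ chart_dom b ((chart_inv a x)^-1)%g]
              (fun x => b ((chart_inv a x)^-1)%g)
}.

#[short(type="lieGroupType")]
HB.structure Definition LieGroup (R : realType) (n : nat) :=
  {G of Topological_Group_isLieGroup R n G & Topological G & Group G}.

Section LieAlgebra.
Variables (R : realType) (n : nat) (G : lieGroupType R n).

Let phi : chart R n G := chart_at (1 : G)%g.
Let phiV : 'rV[R]_n -> G := chart_inv phi.

(* The Lie algebra is T_1 G, i.e. 'rV[R]_n through the chart phi at 1.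
   [left_inv_field v] is the left-invariant vector field with value v at 1,
   written in phi: its value at phi(g) is d(L_g)_1 v. *)
Definition left_inv_field (v x : 'rV[R]_n) : 'rV[R]_n :=
  'D_v (fun y => phi (phiV x * phiV y)%g) (phi 1%g).

Definition vf_bracket (X Y : 'rV[R]_n -> 'rV[R]_n) (x : 'rV[R]_n) : 'rV[R]_n :=
  'D_(X x) Y x - 'D_(Y x) X x.

Definition lie_bracket (u v : 'rV[R]_n) : 'rV[R]_n :=
  vf_bracket (left_inv_field u) (left_inv_field v) (phi 1%g).

Definition Ad (g : G) (v : 'rV[R]_n) : 'rV[R]_n :=
  'D_v (fun y => phi (g * phiV y * g^-1)%g) (phi 1%g).

Definition is_ideal (a : {vspace 'rV[R]_n}) : Prop :=
  forall x y, y \in a -> lie_bracket x y \in a.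

(* By bilinearity this is the span of all brackets of elements of [a]. *)
Definition derived (a : {vspace 'rV[R]_n}) : {vspace 'rV[R]_n} :=
  <<[seq lie_bracket x y | x <- vbasis a, y <- vbasis a]>>%VS.

Definition is_solvable (a : {vspace 'rV[R]_n}) : Prop :=
  exists k, iter k derived a = 0%VS.

Definition semisimple : Prop :=
  forall a : {vspace 'rV[R]_n}, is_ideal a -> is_solvable a -> a = 0%VS.

Definition is_abelian (t : {vspace 'rV[R]_n}) : Prop :=
  forall x y, x \in t -> y \in t -> lie_bracket x y = 0.

Definition maximal_abelian (t : {vspace 'rV[R]_n}) : Prop :=
  is_abelian t /\
  forall t' : {vspace 'rV[R]_n}, is_abelian t' -> (t <= t')%VS -> t' = t.

(* The complexification of 'rV[R]_n is 'rV[R[i]]_n. *)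
Definition cplx (a b : 'rV[R]_n) : 'rV[R[i]]_n :=
  \row_j Complex (a 0 j) (b 0 j).
Definition Re_row (x : 'rV[R[i]]_n) : 'rV[R]_n := map_mx (@complex.Re R) x.
Definition Im_row (x : 'rV[R[i]]_n) : 'rV[R]_n := map_mx (@complex.Im R) x.
Definition conj_row (x : 'rV[R[i]]_n) : 'rV[R[i]]_n := map_mx (@conjc R) x.

(* Complex-(bi)linear extensions. *)
Definition clie_bracket (x y : 'rV[R[i]]_n) : 'rV[R[i]]_n :=
  cplx (lie_bracket (Re_row x) (Re_row y) - lie_bracket (Im_row x) (Im_row y))
       (lie_bracket (Re_row x) (Im_row y) + lie_bracket (Im_row x) (Re_row y)).
Definition cAd (g : G) (x : 'rV[R[i]]_n) : 'rV[R[i]]_n :=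
  cplx (Ad g (Re_row x)) (Ad g (Im_row x)).
Definition ccovector (xi : 'Hom('rV[R]_n, R^o)) (x : 'rV[R[i]]_n) : R[i] :=
  Complex (xi (Re_row x)) (xi (Im_row x)).
Definition cspace (t : {vspace 'rV[R]_n}) : {vspace 'rV[R[i]]_n} :=
  <<[seq cplx v 0 | v <- vbasis t]>>%VS.

(* A left-invariant CR structure is represented by the fibre at 1 of its
   complex subbundle; the second clause says that h meets its conjugate
   trivially. *)
Definition left_invariant_CR (h : {vspace 'rV[R[i]]_n}) : Prop :=
  (forall x y, x \in h -> y \in h -> clie_bracket x y \in h) /\
  (forall x, x \in h -> conj_row x \in h -> x = 0).

Definition maximal_rank (h : {vspace 'rV[R[i]]_n}) : Prop := \dim h = n./2.

Definition levi_form (xi : 'Hom('rV[R]_n, R^o)) (L M : 'rV[R[i]]_n) : R[i] :=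
  (2%:R * Complex 0 1)^-1 * ccovector xi (clie_bracket L (conj_row M)).

Definition levi_flat (h : {vspace 'rV[R[i]]_n}) : Prop :=
  forall xi : 'Hom('rV[R]_n, R^o), xi != 0 ->
    (forall x, x \in h -> ccovector xi x = 0) ->
    forall L M, L \in h -> M \in h -> levi_form xi L M = 0.

Definition root_space (t : {vspace 'rV[R]_n})
    (a : 'Hom(subvs_of (cspace t), R[i]^o)) : set 'rV[R[i]]_n :=
  [set x | forall H : subvs_of (cspace t), clie_bracket (vsval H) x = a H *: x].

Definition is_root (t : {vspace 'rV[R]_n})
    (a : 'Hom(subvs_of (cspace t), R[i]^o)) : Prop :=
  a != 0 /\ exists2 x, root_space a x & x != 0.

Definition positive_system (t : {vspace 'rV[R]_n})
    (Dp : seq 'Hom(subvs_of (cspace t), R[i]^o)) : Prop :=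
  [/\ uniq Dp,
      forall a, a \in Dp -> is_root a,
      forall a, is_root a -> (- a \in Dp) = (a \notin Dp) &
      forall a b, a \in Dp -> b \in Dp -> is_root (a + b) -> a + b \in Dp].

(* The sum is automatically direct: [Ct, Ct] = 0, and the elements of Dp are
   distinct and nonzero. *)
Definition CR0_model (t : {vspace 'rV[R]_n})
    (Dp : seq 'Hom(subvs_of (cspace t), R[i]^o)) (m : {vspace 'rV[R[i]]_n}) :
    set 'rV[R[i]]_n :=
  [set x | exists y z, [/\ y \in m,
     forall a, a \in Dp -> root_space a (z a) & x = y + \sum_(a <- Dp) z a]].

(* The third clause is: m meets g trivially. *)
Definition type_CR0 (t : {vspace 'rV[R]_n})
    (Dp : seq 'Hom(subvs_of (cspace t), R[i]^o))
    (h : {vspace 'rV[R[i]]_n}) : Prop :=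
  exists (g : G) (m : {vspace 'rV[R[i]]_n}),
    [/\ (m <= cspace t)%VS,
        \dim m = (\dim t)./2,
        forall v : 'rV[R]_n, cplx v 0 \in m -> v = 0 &
        [set x | x \in h] = cAd g @` CR0_model Dp m].

End LieAlgebra.

(* Main.v *)
Require Import Defs.
From HB Require Import structures.
From mathcomp Require Import all_boot all_order all_algebra.
From mathcomp Require Import all_classical all_reals all_analysis.
From mathcomp Require Import complex ring lra.
Set Implicit Arguments.
Unset Strict Implicit.
Unset Printing Implicit Defensive.
Import Order.TTheory GRing.Theory Num.Theory.
Import numFieldNormedType.Exports.
Local Open Scope classical_set_scope.
Local Open Scope ring_scope.

(** Why the theorem holds. For a left-invariant CR structure [h] of maximal rank on
    a group of odd dimension, the sum of [h] and its conjugate is the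
    complexification of a real subspace [W] of codimension one in the Lie algebra
    ([real_span_mx_inj]). If [xi] is a covector with kernel [W], Levi-flatness says
    that [xi] vanishes on the brackets [[x, conj y]] for [x], [y] in [h], and
    involutivity that it vanishes on the brackets [[x, y]]; together, [W] is a
    subalgebra ([levi_flat_real_brackets]).

    The Lie algebra of a compact group carries an inner product [Q] for which
    every [ad u] is skew. Let [v] be a [Q]-normal vector to [W]. For [w] in [W], the
    vector [[w, v]] is orthogonal to [W], since [ad w] is skew and preserves [W], and
    to [v], since [ad w] is skew; so it is 0 and [v] is central
    ([codim1_subalgebra_normal_central]). The line of [v] is then a nonzero abelian
    ideal, which semisimplicity forbids.

    Two points carry the existence of [Q]. First, a bounded group of matrices
    preserves an inner product ([bounded_group_invariant_form]): the supremum of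
    the squared norm over an orbit of forms is an invariant strictly convex
    function, whose minimiser on a suitable invariant closed convex set of positive
    definite forms is fixed by the group ([bounded_group_fixed_point]). This
    applies to the adjoint group because [Ad] is a locally bounded homomorphism on
    a compact group ([Ad_mx_bounded]).

    Secondly, invariance under [Ad] must be differentiated into skewness of the
    brackets, which are defined through left-invariant vector fields. Let [dL x]
    and [dR x] be the differentials at 1 of the translations by [x], in the chart
    at 1. Then [Ad x dR x = dL x] as operators on row vectors ([Ad_dR_mx]), and by
    the symmetry of second derivatives ([schwarz]) the operator [ad u] is the
    derivative at 1 along [u] of [dL - dR] ([lie_bracketE]). Invariance of the inverse
    form [P] reads [dL^T P dL = dR^T P dR]; its derivative at 1 is the skewness of
    [ad u] ([ad_skew]). *)

(** * Invariant inner products of bounded matrix groups *)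

Lemma mx_norm_leP (R : realType) m n (M : 'M[R]_(m, n)) (c : R) : 0 <= c ->
  (forall i j, `|M i j| <= c) -> `|M| <= c.
Proof.
by move=> c0 Mc; rewrite [leLHS]/Num.norm/= mx_normrE; apply/bigmax_leP; split.
Qed.

Lemma mx_entry_le_norm (R : realType) m n (M : 'M[R]_(m, n)) i j :
  `|M i j| <= `|M|.
Proof.
rewrite [leRHS]/Num.norm /= mx_normrE; apply/bigmax_geP; right.
by exists (i, j).
Qed.

Lemma mulmx_norm_le (R : realType) m n p (A : 'M[R]_(m, n)) (B : 'M[R]_(n, p)) :
  `|A *m B| <= n%:R * `|A| * `|B|.
Proof.
apply: mx_norm_leP => [|i j]; first by rewrite !mulr_ge0.
rewrite mxE; apply: le_trans (ler_norm_sum _ _ _) _.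
rewrite -mulrA -[n in n%:R]card_ord mulr_natl -sumr_const ler_sum// => k _.
by rewrite normrM ler_pM// mx_entry_le_norm.
Qed.

Definition dotr (R : realType) n (x y : 'rV[R]_n) : R := (x *m y^T) 0 0.

Section Dot.
Context {R : realType} {n : nat}.
Implicit Types x y : 'rV[R]_n.

Lemma dotrE x y : dotr x y = \sum_j x 0 j * y 0 j.
Proof. by rewrite /dotr mxE; apply: eq_bigr => j _; rewrite mxE. Qed.

Lemma dotrC x y : dotr x y = dotr y x.
Proof. by rewrite !dotrE; apply: eq_bigr => j _; rewrite mulrC. Qed.

Lemma dotrDl x y z : dotr (x + y) z = dotr x z + dotr y z.
Proof. by rewrite /dotr mulmxDl mxE. Qed.

Lemma dotrZl a x y : dotr (a *: x) y = a * dotr x y.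
Proof. by rewrite /dotr -scalemxAl mxE. Qed.

Lemma dotrBl x y z : dotr (x - y) z = dotr x z - dotr y z.
Proof. by rewrite dotrDl -scaleN1r dotrZl mulN1r. Qed.

Lemma normr_sqr_le_dotr x : `|x| ^+ 2 <= dotr x x.
Proof.
have q0 : 0 <= dotr x x.
  by rewrite dotrE sumr_ge0// => j _; rewrite -expr2 sqr_ge0.
rewrite -(sqr_sqrtr q0) ler_sqr ?nnegrE ?sqrtr_ge0//.
apply: mx_norm_leP => [|i j]; first by rewrite sqrtr_ge0.
rewrite -(ler_sqr) ?nnegrE ?sqrtr_ge0// sqr_sqrtr// ord1 dotrE (bigD1 j)//=.
rewrite real_normK ?num_real// expr2 lerDl sumr_ge0// => k _.
by rewrite -expr2 sqr_ge0.
Qed.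

Lemma dotr_norm_le x y : `|dotr x y| <= n%:R * `|x| * `|y|.
Proof.
apply: le_trans (mx_entry_le_norm _ _ _) _.
apply: le_trans (mulmx_norm_le _ _) _.
apply: ler_wpM2l; first by rewrite mulr_ge0.
by apply: mx_norm_leP => // i j; rewrite mxE mx_entry_le_norm.
Qed.

(** The quadratic term on the right is what makes a supremum of such squares
    strictly convex. *)
Lemma dotr_parallelogram x y :
  dotr (2^-1 *: (x + y)) (2^-1 *: (x + y)) =
  2^-1 * dotr x x + 2^-1 * dotr y y - 4^-1 * dotr (x - y) (x - y).
Proof.
rewrite !dotrZl ![dotr _ (_ *: _)]dotrC !dotrZl dotrBl ![dotr _ (_ - _)]dotrC.
rewrite !dotrBl dotrDl ![dotr _ (_ + _)]dotrC !dotrDl (dotrC y x).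
lra.
Qed.

Lemma dotr_diff_squares x y :
  dotr x x = dotr y y + dotr (x - y) (x + y).
Proof.
rewrite dotrBl ![dotr _ (_ + _)]dotrC !dotrDl (dotrC y x); ring.
Qed.

End Dot.

Section FixedPoint.
Context {R : realType} {n : nat} {G : groupType}.
Variable rho : G -> 'M[R]_n.
Hypothesis rho1 : rho 1%g = 1%:M.
Hypothesis rhoM : forall g h, rho (g * h)%g = rho g *m rho h.
Variable C : R.
Hypothesis rho_bounded : forall g (x : 'rV[R]_n), `|x *m rho g| <= C * `|x|.
Implicit Types x y : 'rV[R]_n.

Let N x := sup (range (fun g => dotr (x *m rho g) (x *m rho g))).

Let orbit_bound x g : dotr (x *m rho g) (x *m rho g) <= n%:R * (C * `|x|) ^+ 2.
Proof.
apply: le_trans (ler_norm _) _; apply: le_trans (dotr_norm_le _ _) _.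
by rewrite -mulrA ler_wpM2l// expr2 ler_pM.
Qed.

Let orbit_le_N x g : dotr (x *m rho g) (x *m rho g) <= N x.
Proof.
apply: ub_le_sup; last by exists g.
by exists (n%:R * (C * `|x|) ^+ 2) => _ [h _ <-]; exact: orbit_bound.
Qed.

Let N_le x c : (forall g, dotr (x *m rho g) (x *m rho g) <= c) -> N x <= c.
Proof.
move=> xc; apply: ge_sup => [|_ [g _ <-]//].
by exists (dotr (x *m rho 1%g) (x *m rho 1%g)); exists 1%g.
Qed.

Let norm_le_N x : `|x| ^+ 2 <= N x.
Proof.
apply: le_trans (normr_sqr_le_dotr _) _.
by have := orbit_le_N x 1%g; rewrite rho1 mulmx1.
Qed.

Let N_rho x g : N (x *m rho g) <= N x.
Proof. by apply: N_le => h; rewrite -mulmxA -rhoM. Qed.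

Let N_lipschitz x y : N y - N x <= n%:R * (C * `|y - x|) * (C * (`|y| + `|x|)).
Proof.
rewrite lerBlDl; apply: N_le => g.
rewrite (dotr_diff_squares _ (x *m rho g)); apply: lerD => //.
apply: le_trans (ler_norm _) _; apply: le_trans (dotr_norm_le _ _) _.
rewrite -mulmxBl -mulmxDl -!mulrA ler_wpM2l// !mulrA -mulrA ler_pM//.
apply: le_trans (rho_bounded _ _) _.
have [/eqP x0|x0] := boolP (`|y + x| == 0).
  rewrite x0 mulr0; have := rho_bounded 1%g x.
  have := rho_bounded 1%g y; rewrite rho1 !mulmx1 mulrDr.
  by move=> /(le_trans (normr_ge0 _)) ? /(le_trans (normr_ge0 _)) ?; rewrite addr_ge0.
rewrite ler_wpM2l ?ler_normD//.
have := rho_bounded 1%g (y + x); rewrite rho1 mulmx1 -[leLHS]mul1r ler_pM2r.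
  exact: le_trans.
by rewrite lt0r x0 normr_ge0.
Qed.

Let N_continuous : continuous N.
Proof.
move=> x; apply/(@cvgrPdist_le _ _ _ (nbhs x) (nbhs_filter x)) => e e0.
pose L := n%:R * (C * C) * (2 * `|x| + 1).
have key y : `|y - x| <= 1 -> `|N x - N y| <= `|L| * `|y - x|.
  move=> yx; have yn : `|y| <= `|x| + 1.
    by rewrite -[y](subrK x) (le_trans (ler_normD _ _))// [leRHS]addrC lerD2r.
  have s : `|y| + `|x| <= 2 * `|x| + 1 by lra.
  have [CC0 nn] : 0 <= n%:R * (C * C) /\ 0 <= `|y - x|.
    by rewrite normr_ge0 mulr_ge0// -expr2 sqr_ge0.
  have bd : n%:R * (C * C) * `|y - x| * (`|y| + `|x|) <= `|L| * `|y - x|.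
    rewrite ger0_norm /L; last by rewrite mulr_ge0// addr_ge0 ?mulr_ge0.
    by rewrite [leRHS]mulrAC ler_wpM2l// mulr_ge0.
  rewrite ler_norml; apply/andP; split.
    rewrite lerNl opprB; apply: le_trans (N_lipschitz _ _) _.
    by apply: le_trans bd; rewrite le_eqVlt; apply/orP; left; apply/eqP; ring.
  apply: le_trans (N_lipschitz _ _) _; apply: le_trans bd.
  by rewrite distrC le_eqVlt; apply/orP; left; apply/eqP; ring.
have near_le d : 0 < d -> \forall y \near x, `|y - x| <= d.
  by move=> d0; apply/nbhs_normP; exists d => //= y /ltW; rewrite distrC.
near=> y; have yx : `|y - x| <= 1 by near: y; exact: near_le.
apply: le_trans (key y yx) _.
have : `|y - x| <= e / (`|L| + 1).
  by near: y; apply: near_le; rewrite divr_gt0// ltr_wpDl.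
rewrite ler_pdivlMr ?ltr_wpDl//.
by apply: le_trans; rewrite mulrDr mulr1 mulrC lerDl.
Unshelve. all: by end_near. Qed.

(** The function [N x], the supremum of the squared Euclidean lengths of the
    points of the orbit of [x], is invariant and, since the group is bounded,
    finite, continuous and coercive; it therefore attains its minimum on [K].
    The parallelogram identity makes it strictly convex: the lower bound [D] on
    the orbit of the difference of two points, obtained by applying the inverse
    group element, keeps the gain uniform over the group. Hence the minimiser is
    unique, and being unique it is fixed. *)
Lemma bounded_group_fixed_point (K : set 'rV[R]_n) :
  closed K -> K !=set0 ->
  (forall x y, K x -> K y -> K (2^-1 *: (x + y))) ->
  (forall g x, K x -> K (x *m rho g)) ->
  exists2 x, K x & forall g, x *m rho g = x.
Proof.
move=> Kcl [x0 Kx0] Kconv Krho.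
pose A := K `&` [set x | `|x| <= 1 + N x0].
(* Coercivity with an explicit radius: |x|^2 <= N x0 forces |x| <= 1 + N x0. *)
have small x : N x <= N x0 -> `|x| <= 1 + N x0.
  move=> xN; have := le_trans (norm_le_N x) xN => xx0.
  have := sqr_ge0 (`|x| - 1); have := normr_ge0 x; nra.
have Ax0 : A x0 by split => //; exact: small.
have Acpt : compact A.
  apply: bounded_closed_compact; last first.
    have /continuous_closedP nc : continuous (@Num.norm R 'rV[R]_n).
      by move=> x; exact: norm_continuous.
    by apply: closedI => //; exact: (nc _ (@closed_le R (1 + N x0))).
  exists (1 + N x0); split=> [|c cN x [_ xN]]; first exact: num_real.
  exact: le_trans xN (ltW cN).
have [||x Ax xmin] := @compact_EVT_min _ R N A _ Acpt; first by exists x0.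
  by apply: continuous_subspaceT => x; exact: N_continuous.
have xminK y : K y -> N x <= N y.
  move=> Ky; have [yN|/ltW yN] := leP (N y) (N x0); last first.
    by apply: le_trans yN; apply: xmin; rewrite inE.
  by apply: xmin; rewrite inE; split => //; exact: small.
move: Ax; rewrite inE => -[Kx _].
exists x => // g; set y := x *m rho g.
have Ky : K y by exact: Krho.
apply/eqP; rewrite -subr_eq0 -normr_eq0; apply/eqP/le_anti; rewrite normr_ge0 andbT.
have C0 : 0 < 1 + C ^+ 2 by rewrite ltr_wpDr ?sqr_ge0.
(* The [1 +] only guards against [C = 0]. *)
pose D := (1 + C ^+ 2)^-1 * `|x - y| ^+ 2.
have dlow h : D <= dotr ((x - y) *m rho h) ((x - y) *m rho h).
  apply: le_trans (normr_sqr_le_dotr _).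
  rewrite ler_pdivrMl//.
  have := rho_bounded (h^-1)%g ((x - y) *m rho h).
  rewrite -mulmxA -rhoM mulgV rho1 mulmx1 => le1.
  have : `|x - y| ^+ 2 <= (C * `|(x - y) *m rho h|) ^+ 2.
    by rewrite ler_sqr ?nnegrE// (le_trans _ le1).
  by rewrite exprMn => /le_trans; apply; rewrite ler_wpM2r ?sqr_ge0// lerDr.
have : N (2^-1 *: (x + y)) <= N x - 4^-1 * D.
  apply: N_le => h; rewrite -scalemxAl mulmxDl dotr_parallelogram -mulmxBl.
  have := dlow h; have := orbit_le_N x h; have := orbit_le_N y h.
  have := N_rho x g; rewrite -/y; lra.
have := xminK _ (Kconv _ _ Kx Ky) => ? ?.
have : D <= 0 by lra.
rewrite pmulr_rle0 ?invr_gt0// => D0.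
by rewrite distrC leNgt; apply/negP => xy; move: D0; rewrite leNgt exprn_gt0.
Qed.

End FixedPoint.

Lemma mxvec_norm (R : realType) m n (M : 'M[R]_(m, n)) : `|mxvec M| = `|M|.
Proof.
apply/le_anti/andP; split; apply: mx_norm_leP => // i j.
  by case/mxvec_indexP: j => k l; rewrite ord1 mxvecE mx_entry_le_norm.
by rewrite -mxvecE mx_entry_le_norm.
Qed.

Lemma lipschitz_fun_continuous (R : realType) (V W : normedModType R) (f : V -> W) k :
  (forall x y, `|f x - f y| <= k * `|x - y|) -> continuous f.
Proof.
move=> fk x; apply/(@cvgrPdist_le _ _ _ (nbhs x)) => e e0.
have k0 : 0 < `|k| + 1 by rewrite ltr_wpDl.
apply/nbhs_normP; exists (e / (`|k| + 1)); first by rewrite /= divr_gt0.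
move=> y /= xy; apply: le_trans (fk x y) _.
apply: (@le_trans _ _ ((`|k| + 1) * `|x - y|)).
  by rewrite ler_wpM2r// (le_trans (ler_norm k))// lerDl.
by rewrite mulrC -ler_pdivlMr// ltW.
Qed.

Lemma closed_eq_continuous (R : realType) n (f g : 'rV[R]_n -> R) :
  continuous f -> continuous g -> closed [set x | f x = g x].
Proof.
move=> cf cg; rewrite (_ : [set _ | _] = (fun x => f x - g x) @^-1` [set 0]).
  apply: (iffLR (continuous_closedP (fun x => f x - g x))); last exact: closed_eq.
  by move=> x; exact: (@continuousB R R^o _ f g x (cf x) (cg x)).
by apply/seteqP; split=> x /=; [move=> ->; rewrite subrr|move/subr0_eq].
Qed.

(** The group acts on bilinear forms by congruence, and a fixed symmetric form
    is what is wanted. To keep the fixed form positive definite, the fixed point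
    is sought in the convex set [K] of symmetric forms [Q] such that [Q x x] is
    at least every lower bound of the squared lengths on the orbit of [x]: this
    condition is closed and invariant, the standard form satisfies it, and the
    orbit of a nonzero [x] stays away from 0 because the group is bounded. *)
Lemma bounded_group_invariant_form (R : realType) n (G : groupType)
    (A : G -> 'M[R]_n) (C : R) :
  A 1%g = 1%:M -> (forall g h, A (g * h)%g = A h *m A g) ->
  (forall g (x : 'rV[R]_n), `|x *m A g| <= C * `|x|) ->
  exists Q : 'M[R]_n,
    [/\ Q^T = Q, forall x : 'rV[R]_n, x != 0 -> 0 < (x *m Q *m x^T) 0 0 &
        forall g, A g *m Q *m (A g)^T = Q].
Proof.
move=> A1 AM Abd.
(* The action on forms, read on vectorised matrices. *)
pose T g : 'M[R]_(n * n) := lin_mx (fun Q : 'M[R]_n => A g *m Q *m (A g)^T).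
have TE g (q : 'rV[R]_(n * n)) : q *m T g = mxvec (A g *m vec_mx q *m (A g)^T).
  pose f : {linear 'M[R]_n -> 'M[R]_n} := mulmxr (A g)^T \o mulmx (A g).
  exact: (mul_rV_lin f q).
pose ev (x : 'rV[R]_n) (q : 'rV[R]_(n * n)) := (x *m vec_mx q *m x^T) 0 0.
pose K : set 'rV[R]_(n * n) := [set q | (vec_mx q)^T = vec_mx q :> 'M[R]_n /\
  forall x b, (forall g, b <= dotr (x *m A g) (x *m A g)) -> b <= ev x q].
have An g : `|A g| <= `|C|.
  apply: mx_norm_leP => // i j.
  have := Abd g (delta_mx 0 i); rewrite -rowE => le1.
  have : `|row i (A g) 0 j| <= C * `|delta_mx 0 i : 'rV[R]_n|.
    exact: le_trans (mx_entry_le_norm _ _ _) le1.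
  rewrite mxE => /le_trans; apply; apply: (@le_trans _ _ (`|C| * `|delta_mx 0 i : 'rV[R]_n|)).
    by rewrite ler_wpM2r// ler_norm.
  rewrite ler_piMr//; apply: mx_norm_leP => // k l.
  by rewrite mxE; case: (_ && _); rewrite ?normr0 ?normr1.
have T1 : T 1%g = 1%:M.
  apply/row_matrixP => i; rewrite !rowE TE A1 trmx1 mul1mx mulmx1 vec_mxK.
  by rewrite mulmx1.
have TM g h : T (g * h)%g = T g *m T h.
  apply/row_matrixP => i; rewrite !rowE mulmxA !TE mxvecK AM trmx_mul.
  by rewrite !mulmxA.
have Tbd g (q : 'rV[R]_(n * n)) : `|q *m T g| <= n%:R * (n%:R * `|C| * `|C|) * `|q|.
  rewrite TE mxvec_norm; apply: le_trans (mulmx_norm_le _ _) _.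
  have -> : n%:R * (n%:R * `|C| * `|C|) * `|q| = n%:R * (n%:R * `|C| * `|q|) * `|C|.
    ring.
  apply: ler_pM => //.
    rewrite ler_wpM2l//; apply: le_trans (mulmx_norm_le _ _) _.
    by rewrite -(mxvec_norm (vec_mx q)) vec_mxK ler_wpM2r// ler_wpM2l.
  by apply: mx_norm_leP => // i j; rewrite mxE (le_trans (mx_entry_le_norm _ _ _)).
have entry_cont i j : continuous (fun q : 'rV[R]_(n * n) => (vec_mx q : 'M[R]_n) i j).
  apply: (lipschitz_fun_continuous (k := 1)) => p q.
  rewrite mul1r -[p - q](vec_mxK (m := n)) mxvec_norm linearB.
  by apply: le_trans (mx_entry_le_norm _ i j); rewrite !mxE.
have ev_cont x : continuous (ev x).
  apply: (lipschitz_fun_continuous (k := n%:R * (n%:R * `|x|) * `|x|)) => p q.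
  have -> : ev x p - ev x q = dotr (x *m vec_mx (p - q)) x.
    by rewrite /ev /dotr linearB /= mulmxBr mulmxBl !mxE.
  apply: le_trans (dotr_norm_le _ _) _; rewrite [leRHS]mulrAC ler_wpM2r//.
  rewrite -mulrA ler_wpM2l//; apply: le_trans (mulmx_norm_le _ _) _.
  by rewrite -(mxvec_norm (vec_mx _)) vec_mxK.
have Kcl : closed K.
  rewrite (_ : K = (\bigcap_(ij : 'I_n * 'I_n) [set q | vec_mx q ij.2 ij.1 = vec_mx q ij.1 ij.2]) `&`
     \bigcap_(xb in [set xb : 'rV[R]_n * R | forall g, xb.2 <= dotr (xb.1 *m A g) (xb.1 *m A g)]) [set q | xb.2 <= ev xb.1 q]).
    apply: closedI; apply: closed_bigI => -[].
      by move=> i j _ /=; exact: closed_eq_continuous.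
    move=> x b _ /=; exact: (iffLR (continuous_closedP (ev x)) (ev_cont x) _ (@closed_ge R b)).
  apply/seteqP; split=> [q [qs qp]|q [qs qp]]; split.
  - by move=> [i j] _ /=; rewrite -[in LHS]qs mxE.
  - by move=> [x b] /= xb; exact: qp.
  - by apply/matrixP => i j; rewrite mxE (qs (i, j)).
  - by move=> x b xb; exact: (qp (x, b)).
have K0 : K !=set0.
  exists (mxvec 1%:M); split; rewrite ?mxvecK ?trmx1// => x b /(_ 1%g).
  by rewrite A1 mulmx1 /ev mxvecK mulmx1.
have evD x p q : ev x (2^-1 *: (p + q)) = 2^-1 * (ev x p + ev x q).
  by rewrite /ev linearZ linearD /= -scalemxAr -scalemxAl mxE mulmxDr mulmxDl mxE.
have Kconv p q : K p -> K q -> K (2^-1 *: (p + q)).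
  move=> [ps pp] [qs qp]; split; first by rewrite !linearZ !linearD /= ps qs.
  move=> x b xb; rewrite evD; have := pp x b xb; have := qp x b xb; lra.
have Krho g q : K q -> K (q *m T g).
  move=> [qs qp]; rewrite TE; split.
    by rewrite mxvecK !trmx_mul trmxK qs mulmxA.
  move=> x b xb; rewrite /ev mxvecK.
  have := qp (x *m A g) b; rewrite /ev trmx_mul !mulmxA; apply => h.
  by rewrite -mulmxA -AM.
have [q [qs qp] qfix] := bounded_group_fixed_point T1 TM Tbd Kcl K0 Kconv Krho.
exists (vec_mx q); split => //; last first.
  by move=> g; rewrite -[RHS]/(vec_mx q) -[in RHS](qfix g) TE mxvecK.
move=> x x0.
have x0' : 0 < `|x| by rewrite normr_gt0.
pose c : R := (1 + C ^+ 2)^-1 * `|x| ^+ 2.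
have C0 : 0 < 1 + C ^+ 2 by rewrite ltr_wpDr ?sqr_ge0.
have c0 : 0 < c by rewrite mulr_gt0 ?invr_gt0// exprn_gt0.
apply: lt_le_trans c0 _; apply: qp => g.
apply: le_trans (normr_sqr_le_dotr _); rewrite ler_pdivrMl//.
have := Abd (g^-1)%g (x *m A g).
rewrite -mulmxA -AM mulVg A1 mulmx1 => le1.
have : `|x| ^+ 2 <= (C * `|x *m A g|) ^+ 2 by rewrite ler_sqr ?nnegrE// (le_trans _ le1).
by rewrite exprMn => /le_trans; apply; rewrite ler_wpM2r ?sqr_ge0// lerDr.
Qed.

(** * Symmetry of second derivatives *)

Section Calculus.
Context {R : realType}.
Implicit Types V W : normedModType R.

Lemma derive_slice1 V1 V2 W (f : V1 * V2 -> W) x y v :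
  'D_(v, 0) f (x, y) = 'D_v (fun x' => f (x', y)) x.
Proof.
rewrite /derive; do 3 f_equal; apply/funext => h /=.
by rewrite /shift /= -[h *: (v, 0)]/(h *: v, h *: 0) scaler0 -[(_, _) + (_, _)]/(h *: v + x, 0 + y) add0r.
Qed.

Lemma derive_slice2 V1 V2 W (f : V1 * V2 -> W) x y v :
  'D_(0, v) f (x, y) = 'D_v (fun y' => f (x, y')) y.
Proof.
rewrite /derive; do 3 f_equal; apply/funext => h /=.
by rewrite /shift /= -[h *: (0, v)]/(h *: 0, h *: v) scaler0 -[(_, _) + (_, _)]/(0 + x, h *: v + y) add0r.
Qed.

Lemma is_derive_line V (f : V -> R) a u s : derivable f (s *: u + a) u ->
  is_derive s 1 (fun t : R => f (t *: u + a)) ('D_u f (s *: u + a)).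
Proof.
have E : (fun h : R => h^-1 *: (((fun t : R => f (t *: u + a)) \o shift s) (h *: 1) - f (s *: u + a)))
   = (fun h => h^-1 *: ((f \o shift (s *: u + a)) (h *: u) - f (s *: u + a))).
  apply/funext => h; rewrite /= /shift /=; congr (_ *: (f _ - _)).
  by rewrite scalerDl addrA [h *: 1]mulr1.
by move=> fd; split; rewrite /derivable /derive E.
Qed.

Lemma mvt_line V (f : V -> R) a u h : 0 < h ->
  (forall s, 0 <= s <= h -> derivable f (s *: u + a) u) ->
  exists2 s, 0 <= s <= h & f (h *: u + a) - f a = h * 'D_u f (s *: u + a).
Proof.
move=> h0 fd.
have fd' s : 0 <= s <= h -> is_derive s 1 (fun t => f (t *: u + a)) ('D_u f (s *: u + a)).
  by move=> sh; apply: is_derive_line; exact: fd.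
have der s : s \in `]0, h[ -> is_derive s 1 (fun t => f (t *: u + a)) ('D_u f (s *: u + a)).
  by rewrite in_itv/= => /andP[s0 sh]; apply: fd'; rewrite !ltW.
have cont : {within `[0, h], continuous (fun t => f (t *: u + a))}.
  apply: derivable_within_continuous => s; rewrite in_itv/= => sh.
  by have [] := fd' s sh.
have [s sh E] := MVT h0 der cont.
exists s; first by move: sh; rewrite in_itv/= => /andP[s0 sh]; rewrite !ltW.
by move: E; rewrite scale0r add0r subr0 mulrC.
Qed.

(** Two successive uses of the mean value theorem: along [u] for
    [x |-> f (x + h v) - f x], then along [v] for ['D_u f]. The left-hand side is
    symmetric in [u] and [v], hence the symmetry of second derivatives. *)
Lemma second_difference_mvt V (f : V -> R) a u v h : 0 < h ->
  (forall s t, 0 <= s <= h -> 0 <= t <= h ->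
     derivable f (s *: u + (t *: v + a)) u /\
     derivable ('D_u f) (s *: u + (t *: v + a)) v) ->
  exists s t, [/\ 0 <= s <= h, 0 <= t <= h &
    f (h *: u + (h *: v + a)) - f (h *: u + a) - (f (h *: v + a) - f a) =
    h ^+ 2 * 'D_v ('D_u f) (s *: u + (t *: v + a))].
Proof.
move=> h0 fd.
pose g x := f (x + h *: v) - f x.
have hh : 0 <= h <= h by rewrite lexx ltW.
have zz : 0 <= (0 : R) <= h by rewrite lexx ltW.
have gd s : 0 <= s <= h -> is_derive (s *: u + a) u g
   ('D_u f (s *: u + (h *: v + a)) - 'D_u f (s *: u + a)).
  move=> sh.
  have d1 : is_derive (s *: u + a) u (fun x => f (x + h *: v)) ('D_u f (s *: u + (h *: v + a))).
    have E : (fun k : R => k^-1 *: (((fun x => f (x + h *: v)) \o shift (s *: u + a)) (k *: u) - f (s *: u + a + h *: v)))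
       = (fun k => k^-1 *: ((f \o shift (s *: u + (h *: v + a))) (k *: u) - f (s *: u + (h *: v + a)))).
      by apply/funext => k; rewrite /= /shift /= -!addrA [a + h *: v]addrC.
    have [fd1 _] := fd s h sh hh.
    by split; rewrite /derivable /derive E.
  have d2 : is_derive (s *: u + a) u f ('D_u f (s *: u + a)).
    have [+ _] := fd s 0 sh zz; rewrite scale0r add0r => fd1.
    by split.
  exact: is_deriveB.
have [|s sh E] := @mvt_line V g a u h h0.
  by move=> s /gd [].
have [|t th E'] := @mvt_line V ('D_u f) (s *: u + a) v h h0.
  move=> t th; rewrite addrCA; exact: (fd s t sh th).2.
exists s, t; split; [exact: sh|exact: th|].
have Eg x : g x = f (h *: v + x) - f x by rewrite /g [x + _]addrC.
rewrite (addrCA (h *: u)) [s *: u + _]addrCA.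
have [_ gs] := gd s sh.
move: E; rewrite !Eg gs => ->.
by rewrite [s *: u + _]addrCA E' expr2 mulrA.
Qed.

Lemma norm_sub_halves (x y z e : R) :
  `|x - z| <= e / 2 -> `|y - z| <= e / 2 -> `|x - y| <= e.
Proof.
move=> xz yz; rewrite -(subrKA z) (splitr e).
by rewrite (le_trans (ler_normD _ _))// lerD// distrC.
Qed.

(** On each small parallelogram the second difference of [f] is [h ^ 2] times a
    value of either mixed derivative; letting the parallelogram shrink to [a],
    continuity identifies the two derivatives at [a]. *)
Lemma schwarz_real V (f : V -> R) a u v :
  (\forall x \near a, derivable f x u /\ derivable f x v) ->
  (\forall x \near a, derivable ('D_u f) x v /\ derivable ('D_v f) x u) ->
  {for a, continuous ('D_v ('D_u f))} -> {for a, continuous ('D_u ('D_v f))} ->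
  'D_v ('D_u f) a = 'D_u ('D_v f) a.
Proof.
move=> d1 d2 c1 c2; apply/eqP; rewrite -subr_eq0 -normr_eq0; apply/eqP/le_anti.
rewrite normr_ge0 andbT; apply/ler_addgt0Pl => e e0; rewrite addr0.
have e2 : 0 < e / 2 by rewrite divr_gt0.
have n1 : \forall x \near a, `|'D_v ('D_u f) a - 'D_v ('D_u f) x| <= e / 2.
  by move/cvgrPdist_le: c1; apply.
have n2 : \forall x \near a, `|'D_u ('D_v f) a - 'D_u ('D_v f) x| <= e / 2.
  by move/cvgrPdist_le: c2; apply.
have /nbhs_normP[d /= d0 dP] : \forall x \near a, (derivable f x u /\ derivable f x v)
   /\ (derivable ('D_u f) x v /\ derivable ('D_v f) x u) /\
   (`|'D_v ('D_u f) a - 'D_v ('D_u f) x| <= e / 2 /\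
    `|'D_u ('D_v f) a - 'D_u ('D_v f) x| <= e / 2).
  exact: filterI d1 (filterI d2 (filterI n1 n2)).
(* This side length keeps the whole parallelogram inside the ball of radius d. *)
pose h := d / (`|u| + `|v| + 1) / 2.
have uv0 : 0 < `|u| + `|v| + 1 by rewrite ltr_wpDl// addr_ge0.
have h0 : 0 < h by rewrite !divr_gt0.
have small s t : 0 <= s <= h -> 0 <= t <= h -> `|a - (s *: u + (t *: v + a))| < d.
  move=> /andP[s0 sh] /andP[t0 th].
  have -> : a - (s *: u + (t *: v + a)) = - (s *: u + t *: v).
    by rewrite addrA opprD addrCA subrr addr0.
  rewrite normrN; apply: le_lt_trans (ler_normD _ _) _.
  rewrite !normrZ !ger0_norm//.
  apply: (@le_lt_trans _ _ (h * (`|u| + `|v| + 1))).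
    by rewrite mulrDr mulr1 mulrDr -[leLHS]addr0 !lerD// ?ler_wpM2r// ltW.
  rewrite /h mulrAC divfK ?gt_eqF//; lra.
have [|s [t [sh th E1]]] := @second_difference_mvt V f a u v h h0.
  by move=> s t sh th; have [[? ?] [[? ?] _]] := dP _ (small s t sh th).
have [|t' [s' [th' sh' E2]]] := @second_difference_mvt V f a v u h h0.
  move=> t' s' th' sh'; have := dP _ (small s' t' sh' th').
  by rewrite addrCA => -[[_ fv] [[_ fvu] _]]; exact: conj fv fvu.
have [_ [_ [le1 _]]] := dP _ (small s t sh th).
have := dP _ (small s' t' sh' th'); rewrite addrCA => -[_ [_ [_ le2]]].
have : h ^+ 2 * 'D_v ('D_u f) (s *: u + (t *: v + a)) =
       h ^+ 2 * 'D_u ('D_v f) (t' *: v + (s' *: u + a)).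
  have sw (x y z w : R) : x - y - (z - w) = x - z - (y - w) by ring.
  apply: etrans (esym E1) (etrans _ E2).
  by rewrite [h *: v + (h *: u + a)]addrCA; exact: sw.
move/(mulfI (lt0r_neq0 (exprn_gt0 2 h0))) => E.
move: le1; rewrite E => le1; exact: norm_sub_halves le1 le2.
Qed.

Lemma derive_coord V m n (f : V -> 'M[R]_(m, n)) a v i j : derivable f a v ->
  'D_v (fun x => f x i j) a = 'D_v f a i j.
Proof. by move=> fd; rewrite (derive_mx fd) mxE. Qed.

Lemma schwarz V n (f : V -> 'rV[R]_n) a u v :
  (\forall x \near a, derivable f x u /\ derivable f x v) ->
  (\forall x \near a, derivable ('D_u f) x v /\ derivable ('D_v f) x u) ->
  {for a, continuous ('D_v ('D_u f))} -> {for a, continuous ('D_u ('D_v f))} ->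
  'D_v ('D_u f) a = 'D_u ('D_v f) a.
Proof.
move=> d1 d2 c1 c2; apply/rowP => j.
have D1 w : (\forall x \near a, derivable f x w) ->
   \forall x \near a, 'D_w (fun x => f x 0 j) x = 'D_w f x 0 j.
  by apply: filterS => x fx; exact: derive_coord.
have D2 w w' : (\forall x \near a, derivable f x w) ->
   (\forall x \near a, derivable ('D_w f) x w') ->
   \forall x \near a, derivable ('D_w (fun x => f x 0 j)) x w' /\
     'D_w' ('D_w (fun x => f x 0 j)) x = 'D_w' ('D_w f) x 0 j.
  move=> /D1 /near_join fw fw'; near=> x.
  have fx : \forall y \near x, 'D_w (fun x => f x 0 j) y = 'D_w f y 0 j by near: x.
  have fx' : derivable ('D_w f) x w' by near: x.
  rewrite (near_eq_derive w' fx) (derive_coord _ _ fx'); split => //.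
  apply: (near_eq_derivable (f := fun x => 'D_w f x 0 j)).
    by apply: filterS fx => y ->.
  exact: ((derivable_mxP _ _ _).1 fx').
have d1u : \forall x \near a, derivable f x u by apply: filterS d1 => x [].
have d1v : \forall x \near a, derivable f x v by apply: filterS d1 => x [].
have d2u : \forall x \near a, derivable ('D_u f) x v by apply: filterS d2 => x [].
have d2v : \forall x \near a, derivable ('D_v f) x u by apply: filterS d2 => x [].
have uv := D2 _ _ d1u d2u; have vu := D2 _ _ d1v d2v.
pose fj x := f x 0 j.
suff E : 'D_v ('D_u fj) a = 'D_u ('D_v fj) a.
  exact: etrans (esym (nbhs_singleton uv).2) (etrans E (nbhs_singleton vu).2).
have cc (g : V -> 'rV[R]_n) (g' : V -> R) : {for a, continuous g} ->
   (\forall x \near a, g' x = g x 0 j) -> {for a, continuous g'}.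
  move=> cg gg'.
  have cg' : {for a, continuous (fun x => g x 0 j)}.
    exact: (@continuous_comp _ _ _ g (fun M : 'rV[R]_n => M 0 j) a cg
      (@coord_continuous R 1 n 0 j (g a))).
  rewrite /prop_for /continuous_at (nbhs_singleton gg').
  apply: cvg_trans cg'; apply: near_eq_cvg.
  by apply: filterS gg' => x ->.
apply: schwarz_real.
- apply: filterS d1 => x [fu fv].
  by split; [exact: ((derivable_mxP f x u).1 fu 0 j)|exact: ((derivable_mxP f x v).1 fv 0 j)].
- by apply: filterS (filterI uv vu) => x [[fuv _] [fvu _]]; exact: conj fuv fvu.
- by apply: cc c1 _; apply: filterS uv => x [_ E]; exact: E.
- by apply: cc c2 _; apply: filterS vu => x [_ E]; exact: E.
Unshelve. all: by end_near. Qed.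

Lemma cvg_mulmx (T : Type) (F : set_system T) {FF : Filter F} m n p
    (f : T -> 'M[R]_(m, n)) (g : T -> 'M[R]_(n, p))
    (A : 'M[R]_(m, n)) (B : 'M[R]_(n, p)) :
  f x @[x --> F] --> A -> g x @[x --> F] --> B ->
  f x *m g x @[x --> F] --> A *m B.
Proof.
move=> fA gB; apply/cvgrPdist_le => e e0.
pose c := n%:R * (`|A| + `|B| + 1) + 1.
have c0 : 0 < c by rewrite ltr_wpDl// mulr_ge0// !addr_ge0.
have d0 : 0 < e / c by rewrite divr_gt0.
near=> x.
have fx : `|A - f x| <= e / c by near: x; move/cvgrPdist_le: fA; apply.
have gx : `|B - g x| <= e / c by near: x; move/cvgrPdist_le: gB; apply.
have gx1 : `|B - g x| <= 1 by near: x; move/cvgrPdist_le: gB; apply.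
have -> : A *m B - f x *m g x = (A - f x) *m g x + A *m (B - g x).
  by rewrite mulmxBl mulmxBr [RHS]addrC subrKA.
have gb : `|g x| <= `|B| + 1.
  rewrite -[g x](subrK B); apply: le_trans (ler_normD _ _) _.
  by rewrite [leRHS]addrC lerD2r distrC.
apply: le_trans (ler_normD _ _) _.
apply: (@le_trans _ _ (n%:R * (e / c) * (`|B| + 1) + n%:R * `|A| * (e / c))).
  apply: lerD; apply: le_trans (mulmx_norm_le _ _) _.
    by rewrite ler_pM// ?mulr_ge0// ler_wpM2l.
  by rewrite ler_wpM2l// mulr_ge0.
have -> : n%:R * (e / c) * (`|B| + 1) + n%:R * `|A| * (e / c) = (c - 1) * (e / c).
  by rewrite /c addrK; ring.
by rewrite mulrBl mul1r mulrC divfK ?gt_eqF// gerBl ltW.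
Unshelve. all: by end_near. Qed.

End Calculus.

(** * The adjoint representation *)

Section Adjoint.
Context {R : realType} {n : nat} (G : lieGroupType R n).

Definition chart1 : chart R n G := chart_at (1 : G)%g.
Definition coord1 : 'rV[R]_n := chart1 (1 : G)%g.
Local Notation phi := chart1.
Local Notation phiV := (chart_inv chart1).
Local Notation e := coord1.

Definition conj_chart (g : G) (y : 'rV[R]_n) : 'rV[R]_n := phi (g * phiV y * g^-1)%g.

Lemma coord1_img : chart_img phi e.
Proof. exact: chart_funS (chart_at_dom _). Qed.

Lemma chart1_inv_coord1 : phiV e = 1%g.
Proof. exact: chart_funK (chart_at_dom _). Qed.

Lemma near_chart_img (c : chart R n G) x : chart_img c x ->
  \forall y \near x, chart_img c y.
Proof.
by move=> cx; apply: open_nbhs_nbhs; split => //; exact: chart_img_open.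
Qed.

Lemma near_chart_dom (c : chart R n G) g : chart_dom c g ->
  \forall h \near g, chart_dom c h.
Proof.
by move=> cx; apply: open_nbhs_nbhs; split => //; exact: chart_dom_open.
Qed.

Lemma cvg_mulG (T : Type) (F : set_system T) {FF : Filter F} (f g : T -> G) a b :
  f x @[x --> F] --> a -> g x @[x --> F] --> b ->
  (f x * g x)%g @[x --> F] --> (a * b)%g.
Proof.
move=> fa gb; apply: cvg_trans (@lie_mul_continuous R n G (a, b)).
exact: (cvg_app (fun p : G * G => (p.1 * p.2)%g) (cvg_pair fa gb)).
Qed.

Lemma chart1_inv_cvg x : chart_img phi x -> phiV y @[y --> x] --> phiV x.
Proof. by move=> cx; exact: chart_inv_continuous. Qed.

Lemma near_translate_dom (c : chart R n G) g x h : chart_img phi x ->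
  chart_dom c (g * phiV x * h)%g ->
  \forall y \near x, chart_dom c (g * phiV y * h)%g.
Proof.
move=> px cx.
have C : (g * phiV y * h)%g @[y --> x] --> (g * phiV x * h)%g.
  exact: (@cvg_mulG _ (nbhs x) (nbhs_filter x) _ (fun=> h) _ _
    (@cvg_mulG _ (nbhs x) (nbhs_filter x) (fun=> g) phiV _ _ (cvg_cst _) (chart1_inv_cvg px))
    (cvg_cst _)).
exact: C (near_chart_dom cx).
Qed.

Lemma mul_charts_differentiable (a b c : chart R n G) x y :
  atlas a -> atlas b -> atlas c -> chart_img a x -> chart_img b y ->
  chart_dom c (chart_inv a x * chart_inv b y)%g ->
  differentiable (fun p : 'rV[R]_n * 'rV[R]_n => c (chart_inv a p.1 * chart_inv b p.2)%g) (x, y).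
Proof.
move=> aa ab ac ax bx cxy; have [+ _] := lie_mul_smooth _ _ _ aa ab ac 1%N.
by move=> /(_ (x, y)); apply; split.
Qed.

(** Conjugation by [g] leaves the chart at 1 on the way, through [g y], so it is
    factored as left translation into the chart at [g] followed by right
    translation by [g^-1] back into the chart at 1. The factorisation holds only
    where [g y] stays in the chart at [g]. *)
Lemma conj_chart_near_differentiable g :
  exists2 f : 'rV[R]_n -> 'rV[R]_n, differentiable f e &
    \forall y \near e, conj_chart g y = f y.
Proof.
pose c : chart R n G := chart_at g.
pose d : chart R n G := chart_at (g^-1)%g.
have cg : chart_dom c g := chart_at_dom g.
have dg : chart_dom d (g^-1)%g := chart_at_dom (g^-1)%g.
pose L (y : 'rV[R]_n) := c (chart_inv c (c g) * phiV y)%g.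
pose K (z : 'rV[R]_n) := phi (chart_inv c z * chart_inv d (d (g^-1)%g))%g.
have Le : L e = c g by rewrite /L chart1_inv_coord1 mulg1 chart_funK.
exists (K \o L).
  apply: differentiable_comp.
    apply: (@differentiable_comp _ _ _ _ (fun y : 'rV[R]_n => (c g, y))
       (fun p : 'rV[R]_n * 'rV[R]_n => c (chart_inv c p.1 * phiV p.2)%g)).
      exact: differentiable_pair.
    apply: mul_charts_differentiable; rewrite ?chart1_inv_coord1 ?chart_funK ?mulg1//;
      [exact: chart_at_atlas|exact: chart_at_atlas|exact: chart_at_atlas|exact: chart_funS|exact: coord1_img].
  rewrite Le.
  apply: (@differentiable_comp _ _ _ _ (fun y : 'rV[R]_n => (y, d (g^-1)%g))
       (fun p : 'rV[R]_n * 'rV[R]_n => phi (chart_inv c p.1 * chart_inv d p.2)%g)).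
    exact: differentiable_pair.
  apply: mul_charts_differentiable; rewrite ?chart_funK ?mulgV//;
      [exact: chart_at_atlas|exact: chart_at_atlas|exact: chart_at_atlas|exact: chart_funS|exact: chart_funS|exact: chart_at_dom].
have cgd : chart_dom c (g * phiV e * 1)%g by rewrite chart1_inv_coord1 !mulg1.
have := near_translate_dom coord1_img cgd; apply: filterS => y; rewrite mulg1 => cy.
by rewrite /conj_chart /K /L /= !chart_funK.
Qed.

Lemma conj_chart1 g : conj_chart g e = e.
Proof. by rewrite /conj_chart chart1_inv_coord1 mulg1 mulgV. Qed.

Lemma AdE g v : Ad g v = 'D_v (conj_chart g) e. Proof. by []. Qed.

Lemma Ad_diff g (f : 'rV[R]_n -> 'rV[R]_n) v : differentiable f e ->
  (\forall y \near e, conj_chart g y = f y) -> Ad g v = 'd f e v.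
Proof. by move=> fd gf; rewrite AdE (near_eq_derive _ gf) deriveE. Qed.

Lemma Ad_linear g : linear (@Ad R n G g).
Proof.
have [f fd gf] := conj_chart_near_differentiable g.
by move=> a u v; rewrite !(Ad_diff _ fd gf) linearP.
Qed.

Lemma near_conj_dom g : \forall y \near e, chart_dom phi (g * phiV y * g^-1)%g.
Proof.
apply: near_translate_dom coord1_img _.
by rewrite chart1_inv_coord1 mulg1 mulgV; exact: chart_at_dom.
Qed.

Lemma Ad1 v : @Ad R n G 1%g v = v.
Proof.
rewrite AdE (near_eq_derive (g := id)) ?derive_id//.
apply: filterS (near_chart_img coord1_img) => y py.
by rewrite /conj_chart invg1 mulg1 mul1g chart_invK.
Qed.

(** The chain rule at the fixed point [coord1] of all conjugations. *)
Lemma AdM (g h : G) v : Ad (g * h)%g v = Ad g (Ad h v).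
Proof.
have [f fd gf] := conj_chart_near_differentiable g.
have [k kd hk] := conj_chart_near_differentiable h.
have ke : k e = e by rewrite -(nbhs_singleton hk) conj_chart1.
rewrite (Ad_diff _ kd hk) (Ad_diff _ fd gf).
have fd' : differentiable f (k e) by rewrite ke.
rewrite (@Ad_diff _ (f \o k)); last 2 first.
- exact: differentiable_comp.
- have kc : k y @[y --> e] --> e.
    have : k y @[y --> e] --> k e := differentiable_continuous kd.
    by rewrite ke.
  have kf : \forall y \near e, conj_chart g (k y) = f (k y) := kc _ gf.
  apply: filterS (filterI (near_conj_dom h) (filterI hk kf)) => y [yd [yk yf]].
  by rewrite /= -yf -yk /conj_chart chart_funK// !invgM !mulgA.
have D := diff_comp kd fd'; rewrite ke in D; exact: (congr1 (fun F : _ -> _ => F v) D).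
Qed.

End Adjoint.

(** * The bracket as a derivative of translations *)

Lemma mul_lin1_mx (R : pzRingType) m n (f : 'rV[R]_m -> 'rV[R]_n) v :
  linear f -> v *m lin1_mx f = f v.
Proof.
move=> fl; pose L := GRing.isLinear.Build R _ _ _ f fl.
pose F : {linear 'rV[R]_m -> 'rV[R]_n} := HB.pack f L.
exact: (mul_rV_lin1 F v).
Qed.

Section MatrixCalculus.
Context {R : realType}.

Lemma trmx_cvg (T : Type) (F : set_system T) {FF : Filter F} m n
    (f : T -> 'M[R]_(m, n)) (A : 'M[R]_(m, n)) :
  f x @[x --> F] --> A -> (f x)^T @[x --> F] --> A^T.
Proof.
have tc : continuous (@trmx R m n).
  apply: (lipschitz_fun_continuous (k := 1)) => M N.
  rewrite mul1r -linearB /=; apply: mx_norm_leP => // i j.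
  by rewrite mxE mx_entry_le_norm.
by move=> fA; apply: (cvg_comp _ _ fA); exact: tc.
Qed.

Lemma derive_mulmxl (V : normedModType R) m n p (B : 'M[R]_(m, n))
    (M : V -> 'M[R]_(n, p)) a u :
  derivable M a u -> 'D_u (fun x => B *m M x) a = B *m 'D_u M a.
Proof.
move=> Md; apply: cvg_lim => //.
have -> : (fun h : R => h^-1 *: (((fun x => B *m M x) \o shift a) (h *: u) - B *m M a)) =
  (fun h : R => B *m (h^-1 *: ((M \o shift a) (h *: u) - M a))).
  by apply/funext => h /=; rewrite -scalemxAr mulmxBr.
by apply: cvg_mulmx; [exact: cvg_cst|exact: Md].
Qed.

Lemma congruence_quotient n (P Q : 'M[R]_n) (h : R) : h != 0 ->
  Q^T *m P *m (1%:M + h *: Q) + P *m Q =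
  h^-1 *: ((1%:M + h *: Q)^T *m P *m (1%:M + h *: Q) - P).
Proof.
move=> h0.
have -> : (1%:M + h *: Q)^T = 1%:M + h *: Q^T by rewrite linearD linearZ /= trmx1.
set X := 1%:M + h *: Q.
have E1 : (1%:M + h *: Q^T) *m P *m X = P *m X + h *: (Q^T *m P *m X).
  by rewrite mulmxDl mul1mx mulmxDl -!scalemxAl.
have E2 : P *m X = P + h *: (P *m Q) by rewrite /X mulmxDr mulmx1 -scalemxAr.
by rewrite E1 E2 addrAC [P + _]addrC addrK -scalerDr scalerA mulVf// scale1r addrC.
Qed.

(** The product rule for [M^T P M] at a point where [M] is the identity. *)
Lemma cvg_congruence_quotient (V : normedModType R) n (M : V -> 'M[R]_n)
    (P : 'M[R]_n) a u :
  derivable M a u -> M a = 1%:M ->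
  h^-1 *: ((M (h *: u + a))^T *m P *m M (h *: u + a) - P) @[h --> (0 : R)^'] -->
    ('D_u M a)^T *m P + P *m 'D_u M a.
Proof.
move=> Md Ma.
pose q (h : R) := h^-1 *: (M (h *: u + a) - M a).
have qD : q h @[h --> (0 : R)^'] --> 'D_u M a by exact: Md.
have M1 : 1%:M + h *: q h @[h --> (0 : R)^'] --> (1%:M : 'M[R]_n).
  rewrite -[X in _ --> X]addr0 -(scale0r ('D_u M a)).
  apply: cvgD; first exact: cvg_cst.
  apply: cvgZ => //; exact: nbhs_dnbhs.
have lim : (q h)^T *m P *m (1%:M + h *: q h) + P *m q h @[h --> (0 : R)^'] -->
    ('D_u M a)^T *m P *m 1%:M + P *m 'D_u M a.
  apply: cvgD; last exact: (cvg_mulmx (cvg_cst _) qD).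
  exact: (cvg_mulmx (cvg_mulmx (trmx_cvg qD) (cvg_cst _)) M1).
rewrite mulmx1 in lim; apply: cvg_trans lim; apply: near_eq_cvg.
near=> h.
have h0 : h != 0 by near: h; exact: nbhs_dnbhs_neq.
have -> : M (h *: u + a) = 1%:M + h *: q h.
  by rewrite /q scalerA divff// scale1r Ma [RHS]addrC subrK.
exact: congruence_quotient.
Unshelve. all: by end_near. Qed.

End MatrixCalculus.

Section LieAlgebra.
Context {R : realType} {n : nat} (G : lieGroupType R n).
Local Notation phi := (@chart1 R n G).
Local Notation phiV := (chart_inv phi).
Local Notation e := (@coord1 R n G).

Definition chart_mul (p : 'rV[R]_n * 'rV[R]_n) : 'rV[R]_n :=
  phi (phiV p.1 * phiV p.2)%g.
Local Notation mu := chart_mul.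

Definition mul_dom : set ('rV[R]_n * 'rV[R]_n) :=
  [set p | [/\ chart_img phi p.1, chart_img phi p.2 &
               chart_dom phi (phiV p.1 * phiV p.2)%g]].

Lemma chart_mul_smooth : smooth_on mul_dom mu.
Proof. exact: (lie_mul_smooth _ _ _ (chart_at_atlas _) (chart_at_atlas _) (chart_at_atlas _)). Qed.

Lemma chart1_inv_dom x : chart_img phi x -> chart_dom phi (phiV x).
Proof. exact: chart_invS. Qed.

Lemma mul_doml x : chart_img phi x -> mul_dom (e, x).
Proof.
move=> px; split => //=; first exact: coord1_img.
by rewrite chart1_inv_coord1 mul1g; exact: chart1_inv_dom.
Qed.

Lemma mul_domr x : chart_img phi x -> mul_dom (x, e).
Proof.
move=> px; split => //=; first exact: coord1_img.
by rewrite chart1_inv_coord1 mulg1; exact: chart1_inv_dom.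
Qed.

Lemma near_mul_dom : \forall p \near (e, e), mul_dom p.
Proof.
have f1 : p.1 @[p --> (e, e)] --> e := @cvg_fst _ _ (nbhs e) (nbhs e) (nbhs_filter e).
have f2 : p.2 @[p --> (e, e)] --> e := @cvg_snd _ _ (nbhs e) (nbhs e) (nbhs_filter e).
have i1 : \forall p \near (e, e), chart_img phi p.1 := f1 _ (near_chart_img (coord1_img G)).
have i2 : \forall p \near (e, e), chart_img phi p.2 := f2 _ (near_chart_img (coord1_img G)).
have d : \forall p \near (e, e), chart_dom phi (phiV p.1 * phiV p.2)%g.
  have c1 := cvg_comp _ _ f1 (chart1_inv_cvg (coord1_img G)).
  have c2 := cvg_comp _ _ f2 (chart1_inv_cvg (coord1_img G)).
  have C := @cvg_mulG R n G _ (nbhs (e, e)) (nbhs_filter _) _ _ _ _ c1 c2.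
  apply: C; apply: near_chart_dom; rewrite chart1_inv_coord1 mulg1; exact: chart_at_dom.
by apply: filterS (filterI i1 (filterI i2 d)) => p [? [? ?]]; split.
Qed.

Lemma chart_mul_diff p : mul_dom p -> differentiable mu p.
Proof. by case: (chart_mul_smooth 1%N) => + _; apply. Qed.

Lemma derive_chart_mul_diff p w : mul_dom p -> differentiable ('D_w mu) p.
Proof. by case: (chart_mul_smooth 2%N) => _ /(_ w)[+ _]; apply. Qed.

Lemma derive2_chart_mul_cont p w w' : mul_dom p -> {for p, continuous ('D_w' ('D_w mu))}.
Proof. by case: (chart_mul_smooth 2%N) => _ /(_ w)[_ /(_ w')]; apply. Qed.

(** Matrices, acting on row vectors, of the differentials at the identity of the
    right ([dR_mx]) and left ([dL_mx]) translations by the point of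
    coordinates [x]. *)
Definition dR_mx x := lin1_mx (fun v : 'rV[R]_n => 'D_(v, 0) mu (e, x)).
Definition dL_mx x := lin1_mx (fun v : 'rV[R]_n => 'D_(0, v) mu (x, e)).
Definition Ad_mx (g : G) := lin1_mx (@Ad R n G g).

Lemma mul_dR_mx x v : chart_img phi x -> v *m dR_mx x = 'D_(v, 0) mu (e, x).
Proof.
move=> /mul_doml /chart_mul_diff mud; apply: mul_lin1_mx => a u w.
rewrite !deriveE// -linearP; congr ('d mu _ _).
by rewrite -[RHS]/(a *: u + w, a *: 0 + 0) scaler0 addr0.
Qed.

Lemma mul_dL_mx x v : chart_img phi x -> v *m dL_mx x = 'D_(0, v) mu (x, e).
Proof.
move=> /mul_domr /chart_mul_diff mud; apply: mul_lin1_mx => a u w.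
rewrite !deriveE// -linearP; congr ('d mu _ _).
by rewrite -[RHS]/(a *: 0 + 0, a *: u + w) scaler0 addr0.
Qed.

Lemma mul_Ad_mx g v : v *m Ad_mx g = Ad g v.
Proof. exact: mul_lin1_mx (Ad_linear g). Qed.

Lemma mulmx_ext m p (A B : 'M[R]_(m, p)) : (forall v : 'rV[R]_m, v *m A = v *m B) -> A = B.
Proof. by move=> AB; apply/row_matrixP => i; rewrite !rowE AB. Qed.

Lemma dR_mx_coord1 : dR_mx e = 1%:M.
Proof.
apply: mulmx_ext => v; rewrite mul_dR_mx ?mulmx1; last exact: coord1_img.
rewrite derive_slice1 (near_eq_derive (g := id)) ?derive_id//.
apply: filterS (near_chart_img (coord1_img G)) => y py.
by rewrite /mu /= chart1_inv_coord1 mulg1 chart_invK.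
Qed.

Lemma dL_mx_coord1 : dL_mx e = 1%:M.
Proof.
apply: mulmx_ext => v; rewrite mul_dL_mx ?mulmx1; last exact: coord1_img.
rewrite derive_slice2 (near_eq_derive (g := id)) ?derive_id//.
apply: filterS (near_chart_img (coord1_img G)) => y py.
by rewrite /mu /= chart1_inv_coord1 mul1g chart_invK.
Qed.

(** The derivative at [y = 1] of the identity [(x y x^-1) x = x y]. *)
Lemma Ad_dR_mx x : chart_img phi x -> Ad_mx (phiV x) *m dR_mx x = dL_mx x.
Proof.
move=> px; apply: mulmx_ext => v.
rewrite mulmxA mul_Ad_mx (mul_dR_mx _ px) (mul_dL_mx _ px).
have [f fd xf] := conj_chart_near_differentiable (phiV x).
have fe : f e = e by rewrite -(nbhs_singleton xf) conj_chart1.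
have mud : differentiable mu (f e, x) by rewrite fe; exact: chart_mul_diff (mul_doml px).
rewrite derive_slice2 (near_eq_derive (g := mu \o (fun y => (f y, x)))); last first.
  apply: filterS (filterI xf (near_conj_dom (phiV x))) => y [yf yd].
  by rewrite /mu /= -yf /conj_chart chart_funK// -mulgA mulVg mulg1.
have pd : differentiable (fun y => (f y, x)) e by exact: differentiable_pair.
have cd : differentiable (mu \o (fun y => (f y, x))) e := differentiable_comp pd mud.
apply: etrans _ (esym (deriveE v cd)).
apply: etrans _ (esym (congr1 (fun F : _ -> _ => F v) (diff_comp pd mud))).
have D : 'd (fun y => (f y, x)) e v = (Ad (phiV x) v, 0).
  apply: etrans (congr1 (fun F : _ -> _ => F v) (diff_pair fd (differentiable_cst x e))) _.
  exact: (congr2 pair (esym (Ad_diff v fd xf))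
    (congr1 (fun F : _ -> _ => F v) (diff_cst (V := 'rV[R]_n) x e))).
rewrite [RHS]/comp D fe; apply: deriveE.
exact: chart_mul_diff (mul_doml px).
Qed.

Lemma derive_mul_slice1 p w : mul_dom p -> differentiable (fun x => 'D_w mu (x, p.2)) p.1.
Proof.
case: p => x y pd.
apply: (@differentiable_comp _ _ _ _ (fun x => (x, y)) ('D_w mu)).
  exact: differentiable_pair.
exact: derive_chart_mul_diff.
Qed.

Lemma derive_mul_slice2 p w : mul_dom p -> differentiable (fun y => 'D_w mu (p.1, y)) p.2.
Proof.
case: p => x y pd.
apply: (@differentiable_comp _ _ _ _ (fun y => (x, y)) ('D_w mu)).
  exact: differentiable_pair.
exact: derive_chart_mul_diff.
Qed.

Lemma mul_dom_coord1 : mul_dom (e, e).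
Proof. exact: mul_doml (coord1_img G). Qed.

Lemma dR_mx_derivable u : derivable dR_mx e u.
Proof.
apply/derivable_mxP => i j.
have d := diff_derivable (v := u) (derive_mul_slice2 (delta_mx 0 i, 0) mul_dom_coord1).
rewrite (_ : (fun x => dR_mx x i j) = fun x => 'D_(delta_mx 0 i, 0) mu (e, x) 0 j).
  exact: ((derivable_mxP _ _ _).1 d 0 j).
by apply/funext => x; rewrite mxE.
Qed.

Lemma dL_mx_derivable u : derivable dL_mx e u.
Proof.
apply/derivable_mxP => i j.
have d := diff_derivable (v := u) (derive_mul_slice1 (0, delta_mx 0 i) mul_dom_coord1).
rewrite (_ : (fun x => dL_mx x i j) = fun x => 'D_(0, delta_mx 0 i) mu (x, e) 0 j).
  exact: ((derivable_mxP _ _ _).1 d 0 j).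
by apply/funext => x; rewrite mxE.
Qed.

Lemma mx_near_le (M : 'rV[R]_n -> 'M[R]_n) d a : 0 < d ->
  (forall i, {for a, continuous (fun x => row i (M x))}) ->
  \forall x \near a, `|M a - M x| <= d.
Proof.
move=> d0 Mc.
have Mi i : \forall x \near a, `|row i (M a) - row i (M x)| <= d.
  by have /cvgrPdist_le := Mc i; apply.
have : \forall x \near a, forall i, `|row i (M a) - row i (M x)| <= d.
  exact: filter_forall Mi.
apply: filterS => x Mx; apply: mx_norm_leP; first exact: ltW.
move=> i j; apply: le_trans (Mx i); rewrite -linearB /=.
by apply: le_trans (mx_entry_le_norm _ 0 j); rewrite !mxE.
Qed.

Lemma dR_mx_near d : 0 < d -> \forall x \near e, `|1%:M - dR_mx x| <= d.
Proof.
move=> d0; have := @mx_near_le dR_mx d e d0; rewrite dR_mx_coord1; apply => i.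
have -> : (fun x => row i (dR_mx x)) = (fun x => 'D_(delta_mx 0 i, 0) mu (e, x)).
  by apply/funext => x; apply/rowP => j; rewrite !mxE.
exact: differentiable_continuous (derive_mul_slice2 _ mul_dom_coord1).
Qed.

Lemma dL_mx_near d : 0 < d -> \forall x \near e, `|1%:M - dL_mx x| <= d.
Proof.
move=> d0; have := @mx_near_le dL_mx d e d0; rewrite dL_mx_coord1; apply => i.
have -> : (fun x => row i (dL_mx x)) = (fun x => 'D_(0, delta_mx 0 i) mu (x, e)).
  by apply/funext => x; apply/rowP => j; rewrite !mxE.
exact: differentiable_continuous (derive_mul_slice1 _ mul_dom_coord1).
Qed.

(** Near 1, [left_inv_field v] is [x |-> v *m dL_mx x], so the first term of the bracket
    of vector fields is the derivative of [dL_mx] along [u]. The second one is the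
    mixed derivative of the multiplication with [v] on the left factor and [u] on
    the right factor, taken first in [u]; exchanging the two derivations turns it
    into the derivative of [dR_mx] along [u]. *)
Lemma lie_bracketE u v :
  lie_bracket G u v = v *m ('D_u dL_mx e - 'D_u dR_mx e).
Proof.
have XE w x : left_inv_field G w x = 'D_(0, w) mu (x, e) by rewrite derive_slice2.
have Xe w : left_inv_field G w e = w.
  by rewrite XE -mul_dL_mx ?dL_mx_coord1 ?mulmx1//; exact: coord1_img.
have nimg : \forall x \near e, chart_img phi x by exact: near_chart_img (coord1_img G).
rewrite /lie_bracket /vf_bracket -/(chart1 G) -/(coord1 G) !Xe mulmxBr.
congr (_ - _).
  rewrite -derive_mulmxl; last exact: dL_mx_derivable.
  by apply: near_eq_derive; apply: filterS nimg => x px; rewrite XE mul_dL_mx.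
rewrite -derive_mulmxl; last exact: dR_mx_derivable.
have E1 : 'D_v (left_inv_field G u) e = 'D_(v, 0) ('D_(0, u) mu) (e, e).
  rewrite derive_slice1; apply: near_eq_derive.
  by apply/(@filterE _ (nbhs e) (nbhs_filter e)) => x; exact: XE.
have E2 : 'D_u (fun x => v *m dR_mx x) e = 'D_(0, u) ('D_(v, 0) mu) (e, e).
  rewrite derive_slice2; apply: near_eq_derive.
  by apply: filterS nimg => x px; exact: mul_dR_mx.
apply: etrans E1 (etrans _ (esym E2)).
apply: schwarz.
- apply: filterS near_mul_dom => p pd.
  by split; exact: diff_derivable (chart_mul_diff pd).
- apply: filterS near_mul_dom => p pd.
  by split; exact: diff_derivable (derive_chart_mul_diff _ pd).
- exact: derive2_chart_mul_cont mul_dom_coord1.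
- exact: derive2_chart_mul_cont mul_dom_coord1.
Qed.

End LieAlgebra.

(** * An inner product with skew adjoint operators *)

Lemma locally_bounded_compact (R : realType) (T : topologicalType) (f : T -> R) :
  compact [set: T] -> (forall x : T, exists B, \forall y \near x, f y <= B) ->
  exists C, forall x, f x <= C.
Proof.
move=> /compact_near_coveringP Tc fB.
have : \forall C \near +oo, [set: T] `<=` [set y | f y <= C].
  apply: (Tc R +oo (fun C y => f y <= C)) => x _.
  have [B xB] := fB x.
  exists ([set y | f y <= B], [set C | B <= C]).
    by split => //=; apply: nbhs_pinfty_ge; exact: num_real.
  by move=> [y C] /= [yB]; exact: le_trans.
by move=> /filter_ex[C TC]; exists C => x; exact: TC.
Qed.

Lemma near_line (R : realType) (V : normedModType R) (a u : V) (P : V -> Prop) :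
  (\forall x \near a, P x) -> \forall h \near (0 : R), P (h *: u + a).
Proof.
move=> aP.
have c : h *: u + a @[h --> (0 : R)] --> (0 : R) *: u + a.
  by apply: cvgD; [apply: cvgZr_tmp; exact: cvg_id|exact: cvg_cst].
by rewrite scale0r add0r in c; exact: c aP.
Qed.

Lemma congruence_mul (R : comRingType) n (A L N P : 'M[R]_n) :
  A *m L = N -> A^T *m P *m A = P -> N^T *m P *m N = L^T *m P *m L.
Proof.
move=> <- AP; rewrite trmx_mul -[in RHS]AP.
by rewrite !mulmxA.
Qed.

(** Passing from the form [invmx Q] on the dual space back to [Q]: multiply by
    [Q] on both sides. *)
Lemma skew_of_congruence (R : comUnitRingType) n (X Y Q : 'M[R]_n) :
  Q \in unitmx ->
  X^T *m invmx Q + invmx Q *m X = Y^T *m invmx Q + invmx Q *m Y ->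
  (X - Y) *m Q + Q *m (X - Y)^T = 0.
Proof.
move=> Qu XY.
have E : (X - Y)^T *m invmx Q + invmx Q *m (X - Y) = 0.
  by rewrite linearB /= mulmxBl mulmxBr addrACA -opprD XY subrr.
have := congr1 (fun Z => Q *m Z *m Q) E.
rewrite mulmx0 mul0mx mulmxDr mulmxDl !mulmxA mulmxV// mul1mx.
by rewrite -!mulmxA mulVmx// mulmx1 addrC.
Qed.

Lemma derive_congruence_eq (R : realType) (V : normedModType R) n (M N : V -> 'M[R]_n)
    (P : 'M[R]_n) a u :
  derivable M a u -> derivable N a u -> M a = 1%:M -> N a = 1%:M ->
  (\forall x \near a, (M x)^T *m P *m M x = (N x)^T *m P *m N x) ->
  ('D_u M a)^T *m P + P *m 'D_u M a = ('D_u N a)^T *m P + P *m 'D_u N a.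
Proof.
move=> Md Nd Ma Na MN.
have LM := cvg_congruence_quotient (P := P) Md Ma.
have LN := cvg_congruence_quotient (P := P) Nd Na.
have LN' : h^-1 *: ((M (h *: u + a))^T *m P *m M (h *: u + a) - P) @[h --> (0 : R)^'] -->
    ('D_u N a)^T *m P + P *m 'D_u N a.
  apply: cvg_trans LN; apply: near_eq_cvg.
  by apply: filterS (nbhs_dnbhs (near_line u MN)) => h ->.
have hd := @norm_hausdorff R 'M[R]_n.
exact: etrans (esym (cvg_lim hd LM)) (cvg_lim hd LN').
Qed.

Lemma invmx_congruence (R : comUnitRingType) n (A B Q : 'M[R]_n) :
  B *m A = 1%:M -> Q \in unitmx -> A *m Q *m A^T = Q ->
  A^T *m invmx Q *m A = invmx Q.
Proof.
move=> BA Qu AQ.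
have E1 : Q *m A^T = B *m Q by rewrite -{2}AQ !mulmxA BA mul1mx.
have E2 : A^T *m invmx Q = invmx Q *m B.
  have := congr1 (fun X => invmx Q *m X *m invmx Q) E1.
  by rewrite !mulmxA mulVmx// mul1mx -[in RHS]mulmxA mulmxV// mulmx1.
by rewrite E2 -mulmxA BA mulmx1.
Qed.

Section InvariantForm.
Context {R : realType} {n : nat} (G : lieGroupType R n).
Local Notation phi := (@chart1 R n G).
Local Notation phiV := (chart_inv phi).
Local Notation e := (@coord1 R n G).

Lemma Ad_mx1 : Ad_mx (1 : G)%g = 1%:M.
Proof. apply: mulmx_ext => v; rewrite mulmx1; exact: etrans (mul_Ad_mx _ v) (Ad1 G v). Qed.

Lemma Ad_mxM (g h : G) : Ad_mx (g * h)%g = Ad_mx h *m Ad_mx g.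
Proof. by apply: mulmx_ext => v; rewrite mulmxA !mul_Ad_mx AdM. Qed.

(** From [A = N + A (1 - L)] and |A (1 - L)| <= n |A| |1 - L| <= |A| / 2. *)
Lemma mx_bound_of_near1 (A L N : 'M[R]_n) : A *m L = N ->
  `|1%:M - L| <= (n%:R + 1)^-1 / 2 -> `|1%:M - N| <= 1 ->
  `|A| <= 2 * (`|1%:M : 'M[R]_n| + 1).
Proof.
move=> AL L1 N1.
have EA : A = N + A *m (1%:M - L) by rewrite mulmxBr mulmx1 AL addrC subrK.
have Nn : `|N| <= `|1%:M : 'M[R]_n| + 1.
  by rewrite -[N](subKr 1%:M) (le_trans (ler_normB _ _))// lerD2l.
have half : `|A *m (1%:M - L)| <= `|A| / 2.
  apply: le_trans (mulmx_norm_le _ _) _.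
  apply: (@le_trans _ _ (n%:R * `|A| * ((n%:R + 1)^-1 / 2))).
    by rewrite ler_wpM2l// mulr_ge0.
  rewrite mulrA ler_wpM2r ?invr_ge0// mulrAC ler_piMl//.
  by rewrite ler_pdivrMr ?mul1r ?lerDl// ltr_wpDl.
have : `|A| <= `|N| + `|A *m (1%:M - L)| by rewrite {1}EA ler_normD.
lra.
Qed.

Lemma near_one_chart (P : G -> Prop) :
  (\forall x \near e, P (phiV x)) -> \forall g \near (1 : G)%g, P g.
Proof.
move=> nP.
have pc : phi g @[g --> (1 : G)%g] --> e.
  exact: chart_fun_continuous (chart_at_dom _).
have nd : \forall g \near (1 : G)%g, chart_dom phi g.
  by apply: near_chart_dom; exact: chart_at_dom.
by apply: filterS (filterI nd (pc _ nP)) => g [gd]; rewrite /= chart_funK.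
Qed.

Lemma near_translate_one (P : G -> Prop) (g : G) :
  (\forall h \near (1 : G)%g, P h) -> \forall h \near g, P (g^-1 * h)%g.
Proof.
move=> nP.
have C : (g^-1 * h)%g @[h --> g] --> (1 : G)%g.
  rewrite -(mulVg g).
  exact: (@cvg_mulG R n G _ (nbhs g) (nbhs_filter g) (fun=> g^-1)%g id _ _ (cvg_cst _) cvg_id).
exact: C nP.
Qed.

Lemma near_Ad_mx_bounded : \forall g \near (1 : G)%g,
  `|Ad_mx g| <= 2 * (`|1%:M : 'M[R]_n| + 1).
Proof.
have d0 : 0 < (n%:R + 1)^-1 / 2 :> R by rewrite divr_gt0// invr_gt0 ltr_wpDl.
have near1 := dL_mx_near G ltr01.
have nx : \forall x \near e, `|Ad_mx (phiV x)| <= 2 * (`|1%:M : 'M[R]_n| + 1).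
  apply: filterS (filterI (near_chart_img (coord1_img G)) (filterI (dR_mx_near G d0) near1)).
  by move=> x [px [lx rx]]; exact: mx_bound_of_near1 (Ad_dR_mx px) lx rx.
exact: (near_one_chart (P := fun g => `|Ad_mx g| <= 2 * (`|1%:M : 'M[R]_n| + 1)) nx).
Qed.

(** Near 1 the relation between [Ad_mx], [dR_mx] and [dL_mx] bounds [Ad_mx]; the
    homomorphism property translates this bound to a neighbourhood of every
    point, and compactness makes it global. *)
Lemma Ad_mx_bounded : compact [set: G] -> exists C, forall g : G, `|Ad_mx g| <= C.
Proof.
move=> Gc; apply: (locally_bounded_compact (f := fun g : G => `|Ad_mx g|) Gc) => g.
pose B := 2 * (`|1%:M : 'M[R]_n| + 1).
exists (n%:R * B * `|Ad_mx g|).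
have := near_translate_one (P := fun h : G => `|Ad_mx h| <= B) g near_Ad_mx_bounded.
apply: filterS => h hB; rewrite -[in Ad_mx h](mulVKg g h) Ad_mxM.
apply: le_trans (mulmx_norm_le _ _) _.
by rewrite ler_wpM2r// ler_wpM2l.
Qed.

Lemma compact_invariant_form : compact [set: G] ->
  exists Q : 'M[R]_n,
    [/\ Q^T = Q, forall x : 'rV[R]_n, x != 0 -> 0 < (x *m Q *m x^T) 0 0 &
        forall g : G, Ad_mx g *m Q *m (Ad_mx g)^T = Q].
Proof.
move=> /Ad_mx_bounded[C CG].
apply: (@bounded_group_invariant_form R n G (@Ad_mx R n G) (n%:R * C)).
- exact: Ad_mx1.
- exact: Ad_mxM.
- move=> g x; apply: le_trans (mulmx_norm_le _ _) _.
  by rewrite mulrAC ler_wpM2r// ler_wpM2l.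
Qed.

Lemma posdef_unitmx (Q : 'M[R]_n) :
  (forall x : 'rV[R]_n, x != 0 -> 0 < (x *m Q *m x^T) 0 0) -> Q \in unitmx.
Proof.
move=> Qpos; rewrite -row_free_unit -kermx_eq0; apply/negP => /negP/rowV0Pn[v].
move=> /sub_kermxP vQ v0; have := Qpos v v0.
by rewrite vQ mul0mx mxE ltxx.
Qed.

(** Invariance of [Q] under [Ad_mx] is invariance of [P = invmx Q] under the
    transposes, that is [dL^T P dL = dR^T P dR] near 1. The adjoint action has
    disappeared from this identity, whose derivative at 1 along [u] is
    the skewness of the bracket for [P], equivalent to the one for [Q]. *)
Lemma ad_skew (Q : 'M[R]_n) :
  Q \in unitmx -> (forall g : G, Ad_mx g *m Q *m (Ad_mx g)^T = Q) ->
  forall u, let E := 'D_u (dL_mx G) e - 'D_u (dR_mx G) e in E *m Q + Q *m E^T = 0.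
Proof.
move=> Qu Qinv u E; pose P : 'M[R]_n := invmx Q.
have Pinv (g : G) : (Ad_mx g)^T *m P *m Ad_mx g = P.
  apply: (@invmx_congruence _ _ _ (Ad_mx (g^-1)%g)) (Qinv g) => //.
  exact: etrans (esym (Ad_mxM g (g^-1)%g)) (etrans (congr1 (@Ad_mx R n G) (mulgV g)) Ad_mx1).
have eqq : ('D_u (dL_mx G) e)^T *m P + P *m 'D_u (dL_mx G) e =
           ('D_u (dR_mx G) e)^T *m P + P *m 'D_u (dR_mx G) e.
  apply: derive_congruence_eq (dL_mx_coord1 G) (dR_mx_coord1 G) _; [exact: dL_mx_derivable|exact: dR_mx_derivable|].
  apply: filterS (near_chart_img (coord1_img G)) => x px.
  exact: congruence_mul (Ad_dR_mx px) (Pinv (phiV x)).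
exact: skew_of_congruence eqq.
Qed.

End InvariantForm.

(** * Subalgebras of codimension one and Levi-flat structures *)

Lemma mx_eq_oppr0 (R : realFieldType) m n (A : 'M[R]_(m, n)) : A = - A -> A = 0.
Proof.
by move=> AN; apply/matrixP => i j; have := congr1 (fun B : 'M[R]_(m, n) => B i j) AN;
  rewrite !mxE; lra.
Qed.

Section CodimensionOne.
Context {R : realFieldType} {m n : nat}.
Variables (br : 'rV[R]_n -> 'rV[R]_n -> 'rV[R]_n) (ad : 'rV[R]_n -> 'M[R]_n) (Q : 'M[R]_n).
Hypothesis brE : forall x y, br x y = y *m ad x.
Hypothesis brC : forall x y, br x y = - br y x.
Hypothesis Qunit : Q \in unitmx.
Hypothesis Qsym : Q^T = Q.
Hypothesis ad_skew : forall x, ad x *m Q + Q *m (ad x)^T = 0.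

Lemma br_skew x y z : br x y *m Q *m z^T = - (y *m Q *m (br x z)^T).
Proof.
have adQ : ad x *m Q = - (Q *m (ad x)^T) by apply/eqP; rewrite -addr_eq0 ad_skew.
rewrite !brE trmx_mul -[y *m ad x *m Q]mulmxA adQ mulmxN mulNmx.
by rewrite !mulmxA.
Qed.

Lemma br_self x : br x x = 0.
Proof. exact: mx_eq_oppr0. Qed.

(** Let the rows of [W] span a subalgebra and let [v] be normal to it. For [w] in
    the subalgebra, [br w v] is orthogonal to the subalgebra, as [br w] is skew and
    preserves it, and to [v], again by skewness; so it vanishes. Together with
    [br v v = 0] this makes [v] central. *)
Lemma codim1_subalgebra_normal_central (W : 'M[R]_(m, n)) (v : 'rV[R]_n) :
  row_full (col_mx W v) -> v *m Q *m W^T = 0 ->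
  (forall i j, v *m Q *m (br (row i W) (row j W))^T = 0) ->
  forall x, br x v = 0.
Proof.
move=> /row_fullP[B BWv] vW vWW x.
have normal0 z : z *m Q *m W^T = 0 -> z *m Q *m v^T = 0 -> z = 0.
  move=> zW zv; suff zQ : z *m Q = 0 by rewrite -[z](mulmxK Qunit) zQ mul0mx.
  rewrite -[z *m Q]mulmx1 -trmx1 -BWv trmx_mul mulmxA tr_col_mx mul_mx_row zW zv.
  by rewrite row_mx0 mul0mx.
have Wv i : br (row i W) v = 0.
  apply: normal0.
    apply/rowP => j; set z := _ *m Q.
    have -> : (z *m W^T) 0 j = (z *m (row j W)^T) 0 0.
      by rewrite !mxE; apply: eq_bigr => k _; rewrite !mxE.
    by rewrite br_skew vWW oppr0 !mxE.
  have s : v *m Q *m (br (row i W) v)^T = (br (row i W) v *m Q *m v^T)^T.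
    by rewrite !trmx_mul trmxK Qsym mulmxA.
  have := br_skew (row i W) v v; rewrite s.
  set S := br _ _ *m _ *m _; rewrite (_ : S^T = S); last first.
    by apply/matrixP => i' j'; rewrite mxE !ord1.
  exact: mx_eq_oppr0.
have Wad : col_mx W v *m ad v = 0.
  rewrite mul_col_mx -brE br_self.
  rewrite (_ : W *m ad v = 0) ?col_mx0//; apply/row_matrixP => i.
  by rewrite row_mul -brE brC Wv oppr0 row0.
by rewrite brC brE -[x]mulmx1 -BWv -!mulmxA Wad !mulmx0 oppr0.
Qed.
End CodimensionOne.

Lemma Re_mulmx (R : realType) m n p (A : 'M[R[i]]_(m, n)) (B : 'M[R[i]]_(n, p)) :
  map_mx (@complex.Re R) (A *m B) =
  map_mx (@complex.Re R) A *m map_mx (@complex.Re R) B -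
  map_mx (@complex.Im R) A *m map_mx (@complex.Im R) B.
Proof.
have ReD : {morph @complex.Re R : x y / x + y} by move=> [a b] [c d].
apply/matrixP => i j; rewrite !mxE (big_morph _ ReD (erefl _)) -sumrB.
by apply: eq_bigr => k _; rewrite !mxE; case: (A i k) (B k j) => [a b] [c d].
Qed.

Lemma Im_mulmx (R : realType) m n p (A : 'M[R[i]]_(m, n)) (B : 'M[R[i]]_(n, p)) :
  map_mx (@complex.Im R) (A *m B) =
  map_mx (@complex.Re R) A *m map_mx (@complex.Im R) B +
  map_mx (@complex.Im R) A *m map_mx (@complex.Re R) B.
Proof.
have ImD : {morph @complex.Im R : x y / x + y} by move=> [a b] [c d].
apply/matrixP => i j; rewrite !mxE (big_morph _ ImD (erefl _)) -big_split.
by apply: eq_bigr => k _; rewrite !mxE; case: (A i k) (B k j) => [a b] [c d].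
Qed.


Lemma form_orthogonalC (R : comRingType) m n p (Q : 'M[R]_n) (v : 'M[R]_(m, n)) (W : 'M[R]_(p, n)) :
  Q^T = Q -> v *m Q *m W^T = 0 -> W *m Q *m v^T = 0.
Proof.
by move=> Qsym /(congr1 trmx); rewrite !trmx_mul trmxK Qsym mulmxA trmx0.
Qed.

Section NormalVector.
Context {R : realFieldType} {m n : nat}.
Variables (Q : 'M[R]_n) (W : 'M[R]_(m, n)).

Lemma normal_vector_exists : (m < n)%N ->
  exists2 v : 'rV[R]_n, v != 0 & v *m Q *m W^T = 0.
Proof.
move=> mn; have : kermx (Q *m W^T) != 0.
  rewrite kermx_eq0 /row_free neq_ltn (leq_ltn_trans _ mn)//.
  exact: rank_leq_col.
by move=> /rowV0Pn[v /sub_kermxP vW v0]; exists v; rewrite // -mulmxA.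
Qed.

Lemma normal_vector_row_full (v : 'rV[R]_n) : Q^T = Q ->
  (forall x : 'rV[R]_n, x != 0 -> 0 < (x *m Q *m x^T) 0 0) ->
  (forall w : 'rV[R]_m, w *m W = 0 -> w = 0) -> v != 0 -> v *m Q *m W^T = 0 -> n = m.+1 ->
  row_full (col_mx W v).
Proof.
move=> Qsym Qpos Wfree v0 vW nm.
suff /eqP rk : row_free (col_mx W v) by rewrite /row_full rk nm addn1.
rewrite -kermx_eq0; apply/negPn/negP => /rowV0Pn[u /sub_kermxP + u0].
rewrite -[u](hsubmxK (n1 := m)) mul_row_col.
set w := lsubmx _; set c := rsubmx _ => wcW.
have WQv : W *m Q *m v^T = 0.
  exact: form_orthogonalC.
have c0 : c = 0.
  have E : (w *m W + c *m v) *m Q *m v^T = c *m (v *m Q *m v^T).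
    by rewrite !mulmxDl -!mulmxA (mulmxA W) WQv mulmx0 add0r.
  move: E; rewrite wcW !mul0mx => /esym.
  rewrite [v *m Q *m v^T]mx11_scalar mul_mx_scalar => /eqP.
  by rewrite scaler_eq0 gt_eqF ?Qpos//= => /eqP.
move: wcW; rewrite c0 mul0mx addr0 => /Wfree w0.
by move: u0; rewrite -[u](hsubmxK (n1 := m)) -/w -/c w0 c0 row_mx0 eqxx.
Qed.

End NormalVector.

Section ComplexSubspace.
Context {R : realType} {n : nat}.
Variable h : {vspace 'rV[R[i]]_n}.

Definition basis_mx : 'M[R[i]]_(\dim h, n) := \matrix_i (vbasis h)`_i.

Lemma mul_basis_mx (c : 'rV_(\dim h)) : c *m basis_mx = \sum_i c 0 i *: (vbasis h)`_i.
Proof. by rewrite mulmx_sum_row; apply: eq_bigr => i _; rewrite rowK. Qed.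

Lemma row_basis_mx_in i : row i basis_mx \in h.
Proof. by rewrite rowK vbasis_mem// mem_nth// size_tuple. Qed.

Lemma mul_basis_mx_in (c : 'rV_(\dim h)) : c *m basis_mx \in h.
Proof.
rewrite mul_basis_mx memv_suml// => i _; rewrite memvZ// vbasis_mem//.
by rewrite mem_nth// size_tuple.
Qed.

Lemma mem_basis_mx x : x \in h -> exists c : 'rV_(\dim h), x = c *m basis_mx.
Proof.
move=> xh; exists (\row_i coord (vbasis h) i x); rewrite mul_basis_mx.
by rewrite {1}(coord_vbasis xh); apply: eq_bigr => i _; rewrite mxE.
Qed.

Lemma basis_mx_inj (c : 'rV_(\dim h)) : c *m basis_mx = 0 -> c = 0.
Proof.
rewrite mul_basis_mx => c0; apply/rowP => i; rewrite mxE.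
have /freeP := basis_free (vbasisP h); apply; exact: c0.
Qed.

(** Its rows span the real subspace whose complexification is the sum of [h]
    and its conjugate. *)
Definition real_span_mx : 'M[R]_(\dim h + \dim h, n) :=
  col_mx (map_mx (@complex.Re R) basis_mx) (map_mx (@complex.Im R) basis_mx).

(** A real relation [a Re + b Im = 0] between the rows says that the vector of [h]
    with coordinates [a - i b] is purely imaginary; its conjugate is then its
    opposite, which lies in [h] too. *)
Lemma real_span_mx_inj : (forall x, x \in h -> conj_row x \in h -> x = 0) ->
  forall w : 'rV[R]_(\dim h + \dim h), w *m real_span_mx = 0 -> w = 0.
Proof.
move=> hconj w; rewrite -[w]hsubmxK; set a := lsubmx w; set b := rsubmx w.
rewrite mul_row_col => ab0.
pose c : 'rV[R[i]]_(\dim h) := \row_i Complex (a 0 i) (- b 0 i).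
have Rec : map_mx (@complex.Re R) c = a by apply/rowP => i; rewrite !mxE.
have Imc : map_mx (@complex.Im R) c = - b by apply/rowP => i; rewrite !mxE.
have Rex : map_mx (@complex.Re R) (c *m basis_mx) = 0.
  by rewrite Re_mulmx Rec Imc mulNmx opprK.
have x0 : c *m basis_mx = 0.
  apply: hconj; first exact: mul_basis_mx_in.
  rewrite (_ : conj_row _ = - (c *m basis_mx)) ?memvN ?mul_basis_mx_in//.
  apply/rowP => j; move/rowP/(_ j): Rex; rewrite !mxE.
  by case: (\sum_k _) => r s /= ->; congr Complex; rewrite oppr0.
have c0 := basis_mx_inj x0.
have a0 : a = 0 by rewrite -Rec c0; apply/rowP => i; rewrite !mxE.
have b0 : b = 0 by rewrite -[b]opprK -Imc c0; apply/rowP => i; rewrite !mxE oppr0.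
by rewrite a0 b0 row_mx0.
Qed.

Lemma real_span_mx_orthogonal (q : 'cV[R]_n) : real_span_mx *m q = 0 ->
  forall x, x \in h -> Re_row x *m q = 0 /\ Im_row x *m q = 0.
Proof.
rewrite mul_col_mx -col_mx0 => /eq_col_mx[Req Imq] x /mem_basis_mx[c ->].
rewrite /Re_row /Im_row Re_mulmx Im_mulmx mulmxBl mulmxDl -!mulmxA Req Imq.
by rewrite !mulmx0 subr0 addr0.
Qed.

End ComplexSubspace.

Lemma covector_of_col (R : comRingType) n (q : 'cV[R]_n) :
  exists xi : 'Hom('rV[R]_n, R^o), forall x, xi x = (x *m q) 0 0.
Proof.
pose f (x : 'rV[R]_n) : R^o := (x *m q) 0 0.
have fl : linear f by move=> a x y; rewrite /f mulmxDl -scalemxAl !mxE.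
pose F : {linear 'rV[R]_n -> R^o} := HB.pack f (GRing.isLinear.Build R _ _ _ f fl).
by exists (linfun F) => x; rewrite lfunE.
Qed.

Section LeviFlat.
Context {R : realType} {n : nat} (G : lieGroupType R n).
Local Notation br := (lie_bracket G).

Lemma lie_bracketC x y : br x y = - br y x.
Proof. by rewrite /lie_bracket /vf_bracket opprB. Qed.

Lemma lie_bracketNr x y : br x (- y) = - br x y.
Proof. by rewrite !lie_bracketE mulNmx. Qed.

(** A central vector spans an abelian ideal. *)
Lemma central_line_zero v : semisimple G -> (forall x, br x v = 0) -> v = 0.
Proof.
move=> ss cv.
have c0 x y : y \in <[v]>%VS -> br x y = 0.
  move=> /vlineP[k ->]; have := cv x; rewrite !lie_bracketE => E.
  by rewrite -scalemxAl E scaler0.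
have v0 : <[v]>%VS = 0%VS.
  apply: ss; first by move=> x y yv; rewrite c0// mem0v.
  exists 1%N; rewrite /= /derived; apply/eqP; rewrite -subv0; apply/span_subvP => z.
  by move=> /allpairsP[[x y] /= [xb yb ->]]; rewrite c0 ?mem0v// vbasis_mem.
by apply/eqP; rewrite -memv0 -v0 memv_line.
Qed.

Lemma Re_row_cplx (a b : 'rV[R]_n) : Re_row (cplx a b) = a.
Proof. by apply/rowP => j; rewrite !mxE. Qed.

Lemma Im_row_cplx (a b : 'rV[R]_n) : Im_row (cplx a b) = b.
Proof. by apply/rowP => j; rewrite !mxE. Qed.

Lemma Re_conj_row (y : 'rV[R[i]]_n) : Re_row (conj_row y) = Re_row y.
Proof. by apply/rowP => j; rewrite !mxE; case: (y 0 j). Qed.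

Lemma Im_conj_row (y : 'rV[R[i]]_n) : Im_row (conj_row y) = - Im_row y.
Proof. by apply/rowP => j; rewrite !mxE; case: (y 0 j). Qed.

Lemma Re_clie_bracket x y : Re_row (clie_bracket G x y) =
  br (Re_row x) (Re_row y) - br (Im_row x) (Im_row y).
Proof. exact: Re_row_cplx. Qed.

Lemma Im_clie_bracket x y : Im_row (clie_bracket G x y) =
  br (Re_row x) (Im_row y) + br (Im_row x) (Re_row y).
Proof. exact: Im_row_cplx. Qed.

Lemma sum_diff_eq0 (p q r s : R) :
  p - s = 0 -> q + r = 0 -> p + s = 0 -> - q + r = 0 -> [/\ p = 0, q = 0, r = 0 & s = 0].
Proof. by move=> *; split; lra. Qed.

Lemma levi_form_eq0 (xi : 'Hom('rV[R]_n, R^o)) x y : levi_form G xi x y = 0 ->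
  xi (Re_row (clie_bracket G x (conj_row y))) = 0 /\
  xi (Im_row (clie_bracket G x (conj_row y))) = 0.
Proof.
rewrite /levi_form /ccovector; move: (xi _) (xi _) => a b /eqP.
rewrite mulf_eq0 invr_eq0 mulf_eq0 pnatr_eq0 /=.
have -> : (Complex 0 1 == 0 :> R[i]) = false.
  by apply/negbTE/eqP => -[] /eqP; rewrite oner_eq0.
by move=> /eqP[-> ->].
Qed.

(** [xi] vanishes on [[x, y]], which is in [h], and on [[x, conj y]], by
    Levi-flatness; the real and imaginary parts of these two equations determine
    the four real brackets. *)
Lemma levi_flat_real_brackets (h : {vspace 'rV[R[i]]_n}) (xi : 'Hom('rV[R]_n, R^o)) :
  (forall x y, x \in h -> y \in h -> clie_bracket G x y \in h) ->
  levi_flat G h -> xi != 0 ->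
  (forall x, x \in h -> xi (Re_row x) = 0 /\ xi (Im_row x) = 0) ->
  forall x y, x \in h -> y \in h ->
    [/\ xi (br (Re_row x) (Re_row y)) = 0, xi (br (Re_row x) (Im_row y)) = 0,
        xi (br (Im_row x) (Re_row y)) = 0 & xi (br (Im_row x) (Im_row y)) = 0].
Proof.
move=> hbr flat xi0 xih x y xh yh.
have xiB a b : xi (a - b) = xi a - xi b := linearB xi a b.
have xiD a b : xi (a + b) = xi a + xi b := linearD xi a b.
have xiN a : xi (- a) = - xi a := linearN xi a.
have xih' z : z \in h -> ccovector xi z = 0.
  by move=> /xih[r i]; rewrite /ccovector r i.
have [R1 I1] := xih _ (hbr x y xh yh).
have E1 := etrans (esym (xiB _ _)) (etrans (congr1 xi (esym (Re_clie_bracket x y))) R1).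
have E2 := etrans (esym (xiD _ _)) (etrans (congr1 xi (esym (Im_clie_bracket x y))) I1).
have [R2 I2] := levi_form_eq0 (flat xi xi0 xih' x y xh yh).
have E3 := etrans (esym (xiB _ _)) (etrans (congr1 xi (esym (Re_clie_bracket x (conj_row y)))) R2).
have E4 := etrans (esym (xiD _ _)) (etrans (congr1 xi (esym (Im_clie_bracket x (conj_row y)))) I2).
rewrite Re_conj_row Im_conj_row !lie_bracketNr in E3 E4.
rewrite (xiN (br (Im_row x) (Im_row y))) opprK in E3.
rewrite (xiN (br (Re_row x) (Im_row y))) in E4.
exact: sum_diff_eq0 E1 E2 E3 E4.
Qed.

(** The covector [Q v] annihilates [h], so Levi-flatness makes the real span of [h]
    a subalgebra; it has codimension one, because [h] has complex dimension
    [n./2] and [n] is odd, and its normal vector [v] is then central. *)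
Lemma no_levi_flat_CR_of_maximal_rank (h : {vspace 'rV[R[i]]_n}) :
  odd n -> compact [set: G] -> semisimple G ->
  left_invariant_CR G h -> maximal_rank h -> levi_flat G h -> False.
Proof.
move=> hodd hcompact hss [hbr hconj] hrank flat.
have [Q [Qsym Qpos Qinv]] := compact_invariant_form hcompact.
have Qu := posdef_unitmx Qpos.
have nk : n = (\dim h + \dim h).+1.
  by rewrite hrank addnn -[LHS]odd_double_half hodd.
have kn : (\dim h + \dim h < n)%N by exact: eq_leq (esym nk).
have [v v0 vW] := normal_vector_exists Q (real_span_mx h) kn.
have full := normal_vector_row_full Qsym Qpos (real_span_mx_inj hconj) v0 vW nk.
have [xi xiq] := covector_of_col (Q *m v^T).
have xiE x : xi x = (v *m Q *m x^T) 0 0.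
  have E : (x *m Q *m v^T)^T = v *m Q *m x^T by rewrite !trmx_mul trmxK Qsym mulmxA.
  by rewrite xiq mulmxA -E [RHS]mxE.
have xi0 : xi != 0.
  apply/eqP => x0; have := Qpos v v0.
  by rewrite -xiE x0 zero_lfunE ltxx.
have xih x : x \in h -> xi (Re_row x) = 0 /\ xi (Im_row x) = 0.
  have Wq : real_span_mx h *m (Q *m v^T) = 0.
    by rewrite mulmxA; exact: form_orthogonalC.
  by move=> /(real_span_mx_orthogonal Wq)[r i]; rewrite !xiq r i !mxE.
have closed := levi_flat_real_brackets hbr flat xi0 xih.
apply/negP: v0; rewrite negbK; apply/eqP; apply: (central_line_zero hss).
apply: (codim1_subalgebra_normal_central (lie_bracketE G) lie_bracketC Qu Qsym (ad_skew Qu Qinv) full vW).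
have rowE k : exists i, row k (real_span_mx h) = Re_row (row i (basis_mx h)) \/
   row k (real_span_mx h) = Im_row (row i (basis_mx h)).
  case: (split_ordP k) => i ->; exists i; [left|right].
    by rewrite rowKu; apply/rowP => j; rewrite !mxE.
  by rewrite rowKd; apply/rowP => j; rewrite !mxE.
move=> k l; apply/matrixP => r s; rewrite !ord1 -xiE mxE.
have [i ik] := rowE k; have [j jl] := rowE l.
have [E1 E2 E3 E4] := closed _ _ (row_basis_mx_in i) (row_basis_mx_in j).
by case: ik => ->; case: jl => ->; [exact: E1|exact: E2|exact: E3|exact: E4].
Qed.

End LeviFlat.

Theorem theorem5 (R : realType) (n : nat) (G : lieGroupType R n)
    (hodd : odd n) (hcompact : compact [set: G]) (hss : semisimple G)
    (t : {vspace 'rV[R]_n}) (ht : maximal_abelian G t)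
    (Dp : seq 'Hom(subvs_of (cspace t), R[i]^o))
    (hDp : positive_system G Dp) :
  ~ exists h : {vspace 'rV[R[i]]_n},
      [/\ left_invariant_CR G h, maximal_rank h, levi_flat G h &
          type_CR0 G Dp h].
Proof.
by move=> [h [hCR hrank hflat _]]; exact: no_levi_flat_CR_of_maximal_rank hCR hrank hflat.
Qed.
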